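(* Let $D$ be a unimodular cyclotomic plan of index $n$. Let $\mathcal A$ be a family of unimodularized instances of $D$ such that the set $\{\mathrm{len}(A): A\in\mathcal A\}$ is unbounded. Then $\mathcal A$ has well regulated growth of $\mathrm{GUC}$ if and only if $D$ is both balanced and orthogonal.
   Context: An aperiodic sequence is a function $f:\mathbb Z\to\mathbb C$ with finitely many nonzero values $f_j$. For aperiodic $f,g$ and $s\in\mathbb Z$, the crosscorrelation is $C_{f,g}(s)=\sum_{j\in\mathbb Z}f_{j+s}\overline{g_j}$. A codebook is a finite set of aperiodic sequences. For a codebook $F$, $\mathrm{GUC}(F)=\max|C_{f,g}(s)|$ over all $(f,g,s)\in F\times F\times\mathbb Z$ except those of the form $(f,f,0)$, and $\mathrm{SDC}(F)=\min_{f\in F}C_{f,f}(0)$. A family $\mathcal F$ of codebooks with $\{\mathrm{SDC}(F):F\in\mathcal F\}$ unbounded has well regulated growth of $\mathrm{GUC}$ if for every real $\epsilon>0$, $\mathrm{GUC}(F)/\mathrm{SDC}(F)^{1/2+\epsilon}\to0$ as $\mathrm{SDC}(F)\to\infty$. The length of a codebook of sequences all of the same length $\ell$ (length = size of the smallest set of consecutive integers containing the support) is $\ell$. A periodic sequence of length $\ell$ is a function $g:\mathbb Z/\ell\mathbb Z\to\mathbb C$ (indices read mod $\ell$); for $r\in\mathbb Z$ its rotation $g^{(r)}$ is the aperiodic sequence with $g^{(r)}_j=g_{r+j}$ for $0\le j\le \ell-1$ and $g^{(r)}_j=0$ otherwise. For each prime $p$, $\alpha_p$ is a fixed primitive element of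 $\mathbb F_p$; for $n\mid p-1$, $\mathbb F_p^{*n}$ is the subgroup of $n$th powers in $\mathbb F_p^*$. A cyclotomic pattern of index $n$ is a function $d:\mathbb Z/n\mathbb Z\to\mathbb C$; for a prime $p\equiv1\pmod n$ the periodic sequence of length $p$ from $d$ is $f:\mathbb F_p\to\mathbb C$ with $f_0=0$ and $f_h=d_k$ whenever $h\in\alpha_p^k\mathbb F_p^{*n}$. A cyclotomic plan of index $n$ is a finite set $D$ of cyclotomic patterns of index $n$. $D$ is unimodular if every entry of every pattern has modulus $1$; balanced if every pattern has entries summing to $0$; orthogonal if distinct patterns are orthogonal in $\mathbb C^n$ with the inner product $\langle d,d'\rangle=\sum_j d_j\overline{d'_j}$. If $D$ is unimodular and $f_d$ is the periodic sequence of length $p$ from $d$, a unimodularization $\tilde f_d$ of $f_d$ agrees with $f_d$ except that $|\tilde f_{d,0}|=1$. A unimodularized $p$-instance of $D$ is a codebook $\{\tilde f_d^{(r_d)}: d\in D\}$ for some unimodularizations $\tilde f_d$ and integers $r_d$; a unimodularized instance of $D$ is a unimodularized $p$-instance for some prime $p\equiv 1\pmod n$. *)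

(* Defs.v *)
From HB Require Import structures.
From mathcomp Require Import all_boot all_order all_algebra all_field.
From mathcomp Require Import finmap.
From mathcomp Require Import all_classical all_reals.
From mathcomp Require Import exp.
From mathcomp Require Import complex.

Set Implicit Arguments.
Unset Strict Implicit.
Unset Printing Implicit Defensive.

Import Order.TTheory GRing.Theory Num.Theory.
Local Open Scope classical_set_scope.
Local Open Scope ring_scope.

Section Defs.
Variable R : realType.
Local Notation C := R[i].

Definition cabs (z : C) : R := complex.Re `|z|.

Definition aperiodic (f : int -> C) : Prop := finite_set [set j | f j != 0].

Definition codebook (F : set (int -> C)) : Prop :=
  finite_set F /\ (forall f, F f -> aperiodic f).

Definition crosscorr (f g : int -> C) (s : int) : C :=
  \sum_(j \in [set: int]) f (j + s) * Num.conj (g j).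

Definition GUC (F : set (int -> C)) : R :=
  sup [set r : R | exists (f g : int -> C) (s : int),
         [/\ F f, F g, ~ (f = g /\ s = 0) & r = cabs (crosscorr f g s)]].

Definition SDC (F : set (int -> C)) : R :=
  inf [set r : R | exists2 f, F f & (r%:C)%C = crosscorr f f 0].

Definition well_regulated_GUC (Fam : set (set (int -> C))) : Prop :=
  (forall M : R, exists2 F, Fam F & M < SDC F) /\
  (forall eps : R, 0 < eps -> forall delta : R, 0 < delta ->
     exists M : R, forall F, Fam F -> M < SDC F ->
       GUC F / (SDC F `^ (2^-1 + eps)) < delta).

(** Length of an aperiodic sequence: size of the smallest set of consecutive
    integers containing the support. *)
Definition seq_length (f : int -> C) (l : nat) : Prop :=
  (l = 0%N /\ forall j, f j = 0) \/
  (0 < l)%N /\ exists a : int,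
     [/\ f a != 0, f (a + l%:Z - 1) != 0 &
         forall j, f j != 0 -> a <= j <= a + l%:Z - 1].

Definition codebook_length (F : set (int -> C)) (l : nat) : Prop :=
  forall f, F f -> seq_length f l.

Definition pattern (n : nat) := {ffun 'I_n -> C}.

Definition unimodular_plan n (D : {fset pattern n}) : Prop :=
  forall d, d \in D -> forall k, `|d k| = 1.
Definition balanced_plan n (D : {fset pattern n}) : Prop :=
  forall d, d \in D -> \sum_(k < n) d k = 0.
Definition orthogonal_plan n (D : {fset pattern n}) : Prop :=
  forall d d', d \in D -> d' \in D -> d != d' ->
    \sum_(k < n) d k * Num.conj (d' k) = 0.

Definition primitive_elt (p : nat) (a : 'F_p) : Prop := (p.-1).-primitive_root a.

Definition persq_from n (p : nat) (alpha : 'F_p) (d : pattern n) (f : 'F_p -> C)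
  : Prop :=
  (f 0 = 0) /\
  forall (h : 'F_p) (k : 'I_n),
    (exists2 y : 'F_p, y != 0 & h = alpha ^+ k * y ^+ n) -> f h = d k.

Definition unimodularization (p : nat) (f ft : 'F_p -> C) : Prop :=
  (forall h : 'F_p, h != 0 -> ft h = f h) /\ `|ft 0| = 1.

Definition rotation (p : nat) (g : 'F_p -> C) (r : int) : int -> C :=
  fun j => if (0 <= j) && (j <= p%:Z - 1) then g ((r + j)%:~R) else 0.

Definition unimod_p_instance n (D : {fset pattern n}) (p : nat) (alpha : 'F_p)
  (A : set (int -> C)) : Prop :=
  exists (ft : pattern n -> 'F_p -> C) (r : pattern n -> int),
    (forall d, d \in D -> exists2 f, persq_from alpha d f & unimodularization f (ft d))
    /\ A = [set rotation (ft d) (r d) | d in [set d | d \in D]].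

(** Unimodularized instance of D (alpha p: the fixed primitive element of F_p). *)
Definition unimod_instance n (D : {fset pattern n}) (alpha : forall p : nat, 'F_p)
  (A : set (int -> C)) : Prop :=
  exists p : nat, [/\ prime p, p = 1 %[mod n] & unimod_p_instance D (alpha p) A].

End Defs.

(* Main.v *)
(** An aperiodic correlation of two rotated sequences is an incomplete sum of
    [x |-> f_d (x + t) * (f_d' x)^*] over an interval. Expanding the patterns in
    multiplicative characters and completing the sum with additive characters,
    sufficiency reduces to the bound [2 * sqrt p] for
    [\sum_x chi (u - x) * psi (v - x) * e (- x)] (Weil) and to Gauss sums; balance and
    orthogonality remove exactly the trivial characters. Conversely a periodic correlation
    is the sum of two aperiodic ones, and either a zero-shift inner product of two patterns
    or the average of an autocorrelation over all shifts is of order [p].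

    The Weil bound is proved by Stepanov's method. Summing the character over monic
    polynomials gives an L-polynomial of degree 2, so by Newton's identity the sums over the
    field with [p ^ k] elements are [- (a ^+ k + b ^+ k)] with [`|a * b| <= p]. The trivial
    bound gives [`|a|, `|b| < p], whence a weak equidistribution of the field elements among
    the classes defined by the values of the two norms and of the trace. This weak form
    already implies that Stepanov's auxiliary polynomial is nonzero, and its degree bounds
    every class by [Q ^ 2 / M + O(Q)], where [Q ^ 2] is the size of the field and [M] the
    number of classes; thus [a ^+ k + b ^+ k = O(p ^ (k / 2))] for even [k], and
    [`|a|, `|b| <= sqrt p]. *)
Require Import Defs.
From HB Require Import structures.
From mathcomp Require Import all_boot all_order all_algebra all_field.
From mathcomp Require Import finmap.
From mathcomp Require Import all_classical all_reals.
From mathcomp Require Import exp.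
From mathcomp Require Import complex.
From mathcomp Require Import topology normedtype derive trigo.
From mathcomp Require Import cyclic ring lra zify.

Set Implicit Arguments.
Unset Strict Implicit.
Unset Printing Implicit Defensive.

Import Order.TTheory GRing.Theory Num.Theory numFieldNormedType.Exports.
Local Open Scope classical_set_scope.
Local Open Scope ring_scope.

(** * Frobenius in an algebraic closure of a prime field *)

(** The danger in Stepanov's method is that the auxiliary polynomial is zero. If it were, one choice
    of coefficients would kill the attached functions on every class at once; as there are as many
    of these functions as classes, a Vandermonde argument makes the coefficients zero. This only
    asks every class to have more points than a degree of about a quarter of the mean class size,
    and the weak form supplies half of the mean, so nothing is circular. Stepanov bounds classes
    only from above. The other direction is a count: the classes contain all but two points of the
    field, so the deviations from a common upper bound, all of one sign, have a small sum. The
    constants depend on [p], which is harmless because [p] stays fixed while the extension grows.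
    Even degrees are singled out because on the field with [Q ^ 2] elements the map [x -> x ^ Q] is
    an involution. Extensions are not built as types: an element acts through its characteristic
    polynomial over the prime field, whose value at [u] is the norm of [u - x] and whose subleading
    coefficient is minus the trace of [x]. *)

Section ClosureOfFp.
Variables (p : nat) (p_pr : prime p) (K : closedFieldType) (emb : {rmorphism 'F_p -> K}).

Lemma pchar_K : p \in [pchar K].
Proof.
rewrite inE p_pr /= -(rmorph_nat emb).
by rewrite pchar_Fp_0 // rmorph0.
Qed.

Lemma exprD_pk (L : comNzRingType) (charL : p \in [pchar L]) k (x y : L) :
  (x + y) ^+ (p ^ k) = x ^+ (p ^ k) + y ^+ (p ^ k).
Proof. by apply: exprDn_pchar; rewrite pnatX (eq_pnat _ (pcharf_eq charL)) pnat_id. Qed.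

Lemma expr_sum_pk (L : comNzRingType) (charL : p \in [pchar L]) k I (r : seq I) (P : pred I) (F : I -> L) :
  (\sum_(i <- r | P i) F i) ^+ (p ^ k) = \sum_(i <- r | P i) F i ^+ (p ^ k).
Proof.
apply: (big_morph (fun x : L => x ^+ (p ^ k))); first exact: exprD_pk.
by rewrite expr0n expn_eq0 -leqn0 leqNgt prime_gt0.
Qed.

Lemma exprN_pk (L : comNzRingType) (charL : p \in [pchar L]) k (x : L) :
  (- x) ^+ (p ^ k) = - x ^+ (p ^ k).
Proof.
apply/eqP; rewrite -addr_eq0 -exprD_pk // addNr expr0n expn_eq0.
by rewrite -leqn0 leqNgt prime_gt0.
Qed.

Lemma exprB_pk (L : comNzRingType) (charL : p \in [pchar L]) k (x y : L) :
  (x - y) ^+ (p ^ k) = x ^+ (p ^ k) - y ^+ (p ^ k).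
Proof. by rewrite exprD_pk // exprN_pk. Qed.

Lemma embXp (a : 'F_p) k : emb a ^+ (p ^ k) = emb a.
Proof.
rewrite -rmorphXn /=; congr (emb _).
elim: k => [|k IHk]; first by rewrite expr1.
by have := expf_card a; rewrite card_Fp // expnSr exprM IHk.
Qed.

Lemma expr_pk_inj k : injective (fun x : K => x ^+ (p ^ k)).
Proof.
move=> x y /= /eqP; rewrite -subr_eq0 -exprB_pk ?pchar_K //.
by rewrite expf_eq0 => /andP[_]; rewrite subr_eq0 => /eqP.
Qed.

(* The subfield with [p ^ k] elements, given by the list of roots of [X^(p ^ k) - X]
   (meaningless for [k = 0], when this polynomial is [0]). *)
Definition Fq (k : nat) : seq K :=
  sval (closed_field_poly_normal ('X^(p ^ k) - 'X : {poly K})).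

Lemma pk_gt1 k : (0 < k)%N -> (1 < p ^ k)%N.
Proof. by move=> k0; rewrite -{1}(exp1n k) ltn_exp2r // prime_gt1. Qed.

Lemma size_XpkX k : (0 < k)%N -> size ('X^(p ^ k) - 'X : {poly K}) = (p ^ k).+1.
Proof.
move=> k0; rewrite size_polyDl ?size_polyXn // size_polyN size_polyX ltnS.
exact: pk_gt1.
Qed.

Lemma FqE k : (0 < k)%N -> 'X^(p ^ k) - 'X = \prod_(z <- Fq k) ('X - z%:P) :> {poly K}.
Proof.
move=> k0; rewrite /Fq; case: closed_field_poly_normal => r /= {1}->.
rewrite (_ : lead_coef _ = 1) ?scale1r //.
apply/eqP; rewrite -[_ == 1]/(_ \is monic) monicE lead_coefDl ?lead_coefXn //.
by rewrite size_polyN size_polyX size_polyXn ltnS pk_gt1.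
Qed.

Lemma mem_Fq k x : (0 < k)%N -> (x \in Fq k) = (x ^+ (p ^ k) == x).
Proof.
by move=> k0; rewrite -root_prod_XsubC -FqE // rootE !hornerE subr_eq0.
Qed.

Lemma uniq_Fq k : (0 < k)%N -> uniq (Fq k).
Proof.
move=> k0; rewrite -separable_prod_XsubC -FqE // unlock derivB derivXn derivX.
rewrite -scaler_nat natrX (pcharf0 pchar_K) expr0n -leqn0 leqNgt k0 scale0r sub0r.
by rewrite -[- 1]scaleN1r coprimepZr ?coprimep1 // oppr_eq0 oner_eq0.
Qed.

Lemma size_Fq k : (0 < k)%N -> size (Fq k) = (p ^ k)%N.
Proof. by move=> k0; have := size_XpkX k0; rewrite FqE // size_prod_XsubC => -[]. Qed.

(** [X^p - X] has only [p] roots in [K], and the image of [emb] already provides [p] of them. *)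
Lemma fixed_emb x : x ^+ p = x -> exists a : 'F_p, x = emb a.
Proof.
move=> xp.
have uI : uniq [seq emb a | a <- enum 'F_p].
  by rewrite map_inj_uniq ?enum_uniq //; apply: fmorph_inj.
have [||_ /(_ x)] := uniq_min_size uI (_ : {subset _ <= Fq 1}).
- by move=> y /mapP[a _ ->]; rewrite mem_Fq // embXp.
- by rewrite size_Fq // size_map -cardE card_Fp // expn1.
by rewrite mem_Fq // expn1 xp eqxx => /mapP[a _ ->]; exists a.
Qed.

Definition frob_orbit (k : nat) (x : K) : seq K := mkseq (fun i => x ^+ (p ^ i)) k.

(** For [x] in the field with [p ^ k] elements this is the characteristic polynomial of [x] over
    ['F_p], a power of its minimal polynomial. *)
Definition frob_poly (k : nat) (x : K) : {poly K} :=
  \prod_(z <- frob_orbit k x) ('X - z%:P).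

Lemma frob_orbitS k x :
  frob_orbit k.+1 x = x :: [seq z ^+ p | z <- frob_orbit k x].
Proof.
rewrite /frob_orbit /mkseq /= expn0 expr1; congr (_ :: _).
rewrite -map_comp -[1%N]addn0 iotaDl -map_comp; apply: eq_map => i /=.
by rewrite add1n expnSr exprM.
Qed.

Lemma frob_orbitD k l x :
  frob_orbit (k + l) x = frob_orbit k x ++ frob_orbit l (x ^+ (p ^ k)).
Proof.
rewrite /frob_orbit /mkseq iotaD map_cat add0n; congr (_ ++ _).
rewrite -[X in iota X l]addn0 iotaDl -map_comp; apply: eq_map => i /=.
by rewrite expnD exprM.
Qed.

Lemma perm_frob_orbit k x : x ^+ (p ^ k) = x ->
  perm_eq [seq z ^+ p | z <- frob_orbit k x] (frob_orbit k x).
Proof.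
move=> xk; rewrite -(perm_cons x) -frob_orbitS -addn1 frob_orbitD xk.
by rewrite {2}/frob_orbit /mkseq /= expn0 expr1 cats1 perm_rcons.
Qed.

(** Stability under Frobenius makes every coefficient a fixed point of Frobenius, hence an element
    of the prime field. *)
Lemma descend_poly (r : seq K) : perm_eq [seq z ^+ p | z <- r] r ->
  exists2 f : {poly 'F_p}, f \is monic & map_poly emb f = \prod_(z <- r) ('X - z%:P).
Proof.
move=> permr; pose P := \prod_(z <- r) ('X - z%:P).
have fixP i : P`_i ^+ p = P`_i.
  rewrite -[LHS](coef_map (pFrobenius_aut pchar_K)) /= map_prod_XsubC.
  suff -> : \prod_(z <- r) ('X - (pFrobenius_aut pchar_K z)%:P) = P by [].
  by rewrite /P -[RHS](perm_big _ permr) big_map.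
have [a aP] := choice (fun i => fixed_emb (fixP i)).
have fP : map_poly emb (\poly_(i < size P) a i) = P.
  apply/polyP=> i; rewrite coef_map coef_poly.
  by case: ltnP => [_|/(nth_default 0) ->]; [exact/esym/aP | exact: rmorph0].
exists (\poly_(i < size P) a i) => //.
by rewrite -(map_monic emb) fP monic_prod_XsubC.
Qed.

Lemma poly_roots_Fp (f : {poly 'F_p}) : f \is monic ->
  exists2 r : seq K, map_poly emb f = \prod_(z <- r) ('X - z%:P) &
    perm_eq [seq z ^+ p | z <- r] r.
Proof.
move=> fm; have [r rP] := closed_field_poly_normal (map_poly emb f).
have {}rP : map_poly emb f = \prod_(z <- r) ('X - z%:P).
  by rewrite {1}rP lead_coef_map (monicP fm) rmorph1 scale1r.
exists r => //; apply: prod_XsubC_eq; rewrite -rP.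
rewrite big_map -(map_prod_XsubC (pFrobenius_aut pchar_K)) -rP.
apply/polyP=> i; rewrite !coef_map /= -{2}(embXp f`_i 1) expn1.
by rewrite pFrobenius_autE.
Qed.

Lemma dvdp_prod_count (s r : seq K) :
  (\prod_(z <- s) ('X - z%:P) %| \prod_(z <- r) ('X - z%:P)) <->
  (forall z, count_mem z s <= count_mem z r)%N.
Proof.
split.
  case/dvdp_prod_XsubC=> m; rewrite eqp_monic ?monic_prod_XsubC // => /eqP /prod_XsubC_eq ps.
  apply/count_subseqP; exists (mask m r) => //; exact: mask_subseq.
case/count_subseqP=> t /perm_to_subseq[u ur] st.
by rewrite (perm_big _ ur) big_cat /= -(perm_big _ st) dvdp_mulr.
Qed.

(** Pigeonhole in the finite Frobenius-stable list [r], followed by injectivity of Frobenius; [K]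
    itself is not assumed algebraic over the prime field. *)
Lemma frob_period (r : seq K) x : perm_eq [seq z ^+ p | z <- r] r -> x \in r ->
  exists k, (0 < k)%N && (x ^+ (p ^ k) == x).
Proof.
move=> permr xr.
have orbr i : x ^+ (p ^ i) \in r.
  elim: i => [|i IHi]; first by rewrite expr1.
  by rewrite expnSr exprM -(perm_mem permr); apply: (map_f (fun z => z ^+ p)).
have: ~~ uniq (frob_orbit (size r).+1 x).
  apply/negP=> U; have: (size (frob_orbit (size r).+1 x) <= size r)%N.
    by apply: (uniq_leq_size U) => y /mapP[i _ ->].
  by rewrite size_mkseq ltnn.
case/(uniqPn 0) => i [j [ij]]; rewrite size_mkseq => jr.
rewrite !nth_mkseq ?(ltn_trans ij) // => xij; exists (j - i)%N.
rewrite subn_gt0 ij; apply/eqP/(@expr_pk_inj i) => /=.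
by rewrite -exprM -expnD subnK // ltnW.
Qed.

Lemma count_frob_orbit d e x z : x ^+ (p ^ d) = x ->
  count_mem z (frob_orbit (d * e) x) = (e * count_mem z (frob_orbit d x))%N.
Proof.
move=> xd; elim: e => [|e IHe]; first by rewrite muln0.
by rewrite mulnS frob_orbitD xd count_cat IHe.
Qed.

Lemma count_frob (r : seq K) x k : perm_eq [seq z ^+ p | z <- r] r ->
  count_mem (x ^+ (p ^ k)) r = count_mem x r.
Proof.
move=> permr; elim: k => [|k IHk]; first by rewrite expr1.
rewrite expnSr exprM -(permP permr) count_map -IHk; apply: eq_count => y /=.
by have := inj_eq (@expr_pk_inj 1) y (x ^+ (p ^ k)); rewrite expn1.
Qed.

Lemma frob_periodE d (x : K) k :
  (forall l, (0 < l)%N && (x ^+ (p ^ l) == x) -> (d <= l)%N) -> (0 < d)%N ->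
  x ^+ (p ^ d) = x -> (x ^+ (p ^ k) == x) = (d %| k)%N.
Proof.
move=> dmin d0 xd.
have xdm e : x ^+ (p ^ (d * e)) = x.
  elim: e => [|e IHe]; first by rewrite muln0 expr1.
  by rewrite mulnS expnD exprM xd.
apply/idP/idP => [xk|/dvdnP[e ->]]; last by rewrite mulnC xdm.
have [k0|k0] := posnP (k %% d); first by rewrite /dvdn k0.
have: (d <= k %% d)%N.
  apply: dmin; rewrite k0 /=; move: xk.
  by rewrite {1}(divn_eq k d) expnD exprM [(_ * d)%N]mulnC xdm.
by rewrite leqNgt ltn_mod d0.
Qed.

Lemma sum_divisible_le d m u : (0 < d)%N -> (d * u <= m)%N ->
  (\sum_(1 <= k < m.+1) (d %| k) && (k %/ d <= u))%N = u.
Proof.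
move=> d0 dum; rewrite -big_mkcond sum1_count -size_filter.
rewrite -[RHS](size_iota 1) -[RHS](size_map (muln d)); apply: perm_size.
apply: uniq_perm; first by rewrite filter_uniq ?iota_uniq.
  by rewrite map_inj_uniq ?iota_uniq // => x y /eqP; rewrite eqn_pmul2l // => /eqP.
move=> k; rewrite mem_filter mem_index_iota; apply/idP/mapP.
  case/andP=> /andP[/dvdnP[e ->]]; rewrite mulnK // => eu /andP[k1 _].
  exists e; last by rewrite mulnC.
  by rewrite mem_iota add1n ltnS eu andbT; move: k1; rewrite muln_gt0 => /andP[].
case=> e; rewrite mem_iota add1n ltnS => /andP[e0 eu] ->.
rewrite dvdn_mulr //= mulKn // eu muln_gt0 d0 e0 /= ltnS.
by rewrite (leq_trans _ dum) // leq_mul2l eu orbT.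
Qed.

(** If [x] has Frobenius period [d], then [frob_poly (d * e) x] is the [e]-th power of the minimal
    polynomial of [x], so it divides the product exactly when [e] is at most the multiplicity of
    [x]. The indices counted are thus the multiples of [d], as many as this multiplicity. *)
Lemma count_frob_poly_dvd_root (r : seq K) x : perm_eq [seq z ^+ p | z <- r] r ->
  x \in r ->
  (\sum_(1 <= k < (size r).+1)
     ((x ^+ (p ^ k) == x) && (frob_poly k x %| \prod_(z <- r) ('X - z%:P)))%R)%N
  = count_mem x r.
Proof.
move=> permr xr; have [d /andP[d0 /eqP xd] dmin] := ex_minnP (frob_period permr xr).
have xE k := frob_periodE k dmin d0 xd.
have uorb : uniq (frob_orbit d x).
  apply: contraT => /(uniqPn 0)[i [j [ij]]]; rewrite size_mkseq => jd.
  rewrite !nth_mkseq ?(ltn_trans ij) // => xij.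
  suff: (d <= j - i)%N by rewrite leqNgt (leq_ltn_trans (leq_subr _ _)).
  apply: dmin; rewrite subn_gt0 ij; apply/eqP/(@expr_pk_inj i) => /=.
  by rewrite -exprM -expnD subnK // ltnW.
have dvdE e : (frob_poly (d * e) x %| \prod_(z <- r) ('X - z%:P)) = (e <= count_mem x r)%N.
  apply/idP/idP => [/dvdp_prod_count/(_ x)|le].
    rewrite count_frob_orbit // count_uniq_mem // -[d in frob_orbit d](prednK d0).
    by rewrite frob_orbitS mem_head muln1.
  apply/dvdp_prod_count => z; rewrite count_frob_orbit // count_uniq_mem //.
  case: (boolP (z \in _)) => [/mapP[i _ ->]|_]; last by rewrite muln0.
  by rewrite muln1 count_frob.
rewrite -[RHS](@sum_divisible_le d (size r)) //.
  apply: eq_bigr => k _; rewrite xE; congr (nat_of_bool _).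
  by case: (boolP (d %| k)%N) => //= /dvdnP[e ->]; rewrite mulnC dvdE mulKn.
(* The largest of these multiples stays in the summation range because the corresponding Frobenius
   polynomial divides the product over [r]. *)
have := dvdE (count_mem x r); rewrite leqnn => /dvdp_prod_count /count_subseqP[t].
move=> /size_subseq sz /perm_size; rewrite size_mkseq => ->; exact: sz.
Qed.

Lemma sum_count_frob_poly (f : {poly 'F_p}) m : f \is monic -> size f = m.+1 ->
  (\sum_(1 <= k < m.+1) count (fun x => (frob_poly k x %| map_poly emb f)%R) (Fq k))%N = m.
Proof.
move=> fm sf; have [r fr permr] := poly_roots_Fp fm.
have sr : size r = m.
  by have := size_map_poly emb f; rewrite fr size_prod_XsubC sf => -[].
rewrite -[RHS]sr -[in RHS]sum1_size -[in RHS]big_undup_iterop_count /=.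
transitivity (\sum_(x <- undup r) count_mem x r)%N; last first.
  by apply: eq_bigr => x _; case: (count_mem x r) => // n; rewrite /iterop; elim: n => //= n <-.
transitivity (\sum_(1 <= k < m.+1) \sum_(x <- undup r)
    ((x ^+ (p ^ k) == x) && (frob_poly k x %| \prod_(z <- r) ('X - z%:P)))%R)%N.
  rewrite big_nat [RHS]big_nat; apply: eq_bigr => k /andP[k0 _].
  rewrite fr -big_mkcond sum1_count -!size_filter; apply/perm_size/uniq_perm.
  - exact/filter_uniq/uniq_Fq.
  - exact/filter_uniq/undup_uniq.
  move=> x; rewrite !mem_filter mem_undup mem_Fq // andbC -andbA.
  case: eqP => //= _; case: (boolP (frob_poly k x %| _)) => //= /dvdp_prod_count/(_ x).
  rewrite -(prednK k0) frob_orbitS /= eqxx add1n => /(leq_ltn_trans (leq0n _)).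
  by rewrite -has_count => /hasP[y yr /eqP <-].
rewrite exchange_big /= big_seq [RHS]big_seq; apply: eq_bigr => x.
by rewrite mem_undup => xr; rewrite -count_frob_poly_dvd_root // sr.
Qed.

End ClosureOfFp.

(** * Character sums over monic polynomials *)

Definition mulchar (p : nat) (C : pzRingType) (chi : 'F_p -> C) : Prop :=
  [/\ chi 0 = 0, chi 1 = 1 & {morph chi : x y / x * y}].

Definition addchar (p : nat) (C : pzRingType) (e : 'F_p -> C) : Prop :=
  e 0 = 1 /\ (forall x y, e (x + y) = e x * e y).

(* The coefficient of degree [deg f - 1]; the factor ['X] makes it [0] when [f] is constant. *)
Definition subleading (R : nzRingType) (f : {poly R}) : R := ('X * f)`_(size f).-1.

Lemma monic_tail (R : nzRingType) (f : {poly R}) m : f \is monic -> size f = m.+1 ->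
  (size (f - 'X^m)%R <= m)%N.
Proof.
move=> fm sf; apply/leq_sizeP => i mi; rewrite coefB coefXn.
move: mi; rewrite leq_eqVlt => /predU1P[<-|mi].
  by rewrite eqxx; move/monicP: fm; rewrite lead_coefE sf => ->; rewrite subrr.
by rewrite gtn_eqF // nth_default ?sf // subrr.
Qed.

Lemma monic_add_Xn (R : nzRingType) (g : {poly R}) m : (size g <= m)%N ->
  'X^m + g \is monic /\ size ('X^m + g) = m.+1.
Proof.
move=> sg; have szX : (size g < size ('X^m : {poly R}))%N by rewrite size_polyXn ltnS.
by rewrite monicE lead_coefDl ?lead_coefXn ?size_polyDl ?size_polyXn.
Qed.

Lemma subleadingXn (R : nzRingType) (g : {poly R}) m : (size g <= m)%N ->
  subleading ('X^m + g) = ('X * g)`_m.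
Proof.
move=> sg; rewrite /subleading (monic_add_Xn sg).2 /= mulrDr -exprS coefD coefXn.
by rewrite ltn_eqF ?add0r.
Qed.

(** Minus the sum of the roots is additive; this makes [Lam] completely multiplicative. *)
Lemma subleadingM (R : idomainType) (f g : {poly R}) : f \is monic -> g \is monic ->
  subleading (f * g) = subleading f + subleading g.
Proof.
move=> fm gm; have [f0 g0] := (monic_neq0 fm, monic_neq0 gm).
have [m sf] : exists m, size f = m.+1 by exists (size f).-1; rewrite prednK ?size_poly_gt0.
have [l sg] : exists l, size g = l.+1 by exists (size g).-1; rewrite prednK ?size_poly_gt0.
have [sf' sg'] := (monic_tail fm sf, monic_tail gm sg).
have [fE gE] : f = 'X^m + (f - 'X^m) /\ g = 'X^l + (g - 'X^l) by split; rewrite addrC subrK.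
move: (f - _) (g - _) sf' sg' fE gE => f' g' sf' sg' fE gE.
rewrite fE gE !subleadingXn // -fE -gE /subleading size_mul // sf sg /= addnS /=.
have -> : 'X * (f * g) = 'X^((m + l).+1) + 'X^m * ('X * g') + 'X^l * ('X * f') + 'X * f' * g'.
  by rewrite fE gE exprS exprD; ring.
rewrite !coefD coefXn ltn_eqF // add0r !coefXnM ltnNge leq_addr /= addKn.
rewrite ltnNge leq_addl /= addnK [LHS]addrC nth_default ?add0r 1?addrC //.
have [->|f'0] := eqVneq f' 0; first by rewrite mulr0 mul0r size_poly0.
have [->|g'0] := eqVneq g' 0; first by rewrite mulr0 size_poly0.
by rewrite size_mul ?mulf_neq0 ?polyX_eq0 // [_ * f']mulrC size_mulX //= leq_add.
Qed.

Section LSeries.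
Variables (p : nat) (p_pr : prime p) (K : closedFieldType) (emb : {rmorphism 'F_p -> K}).
Variables (C : comNzRingType) (chi psi e : 'F_p -> C) (u v : 'F_p).
Hypotheses (chiP : mulchar chi) (psiP : mulchar psi) (eP : addchar e).

(** On the characteristic polynomial of [x] the arguments of [chi], [psi] and [e] are the norms of
    [u - x] and [v - x] and minus the trace of [x]. *)
Definition Lam (f : {poly 'F_p}) : C := chi f.[u] * psi f.[v] * e (subleading f).

Definition rVmonic m (a : 'rV['F_p]_m) : {poly 'F_p} := 'X^m + rVpoly a.

(** The coefficient of degree [m] of the L-series. Row vectors of lower coefficients index the monic
    polynomials of degree [m] by a finite type. *)
Definition Hsum (m : nat) : C := \sum_(a : 'rV['F_p]_m) Lam (rVmonic a).

(** The descent of [frob_poly] to the prime field; the default [0] is never met on the field with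
    [p ^ k] elements. *)
Definition Fpoly (k : nat) (x : K) : {poly 'F_p} :=
  xget 0 [set f | f \is monic /\ map_poly emb f = frob_poly p k x].

Definition Ssum (k : nat) : C := \sum_(x <- Fq p K k) Lam (Fpoly k x).

Lemma LamM f g : f \is monic -> g \is monic -> Lam (f * g) = Lam f * Lam g.
Proof.
case: chiP psiP eP => [_ _ chiM] [_ _ psiM] [_ eD] fm gm.
by rewrite /Lam subleadingM // !hornerM chiM psiM eD; ring.
Qed.

Lemma FpolyP k x : x ^+ (p ^ k) = x ->
  Fpoly k x \is monic /\ map_poly emb (Fpoly k x) = frob_poly p k x.
Proof.
move=> xk; have [f fm fE] := descend_poly p_pr emb (perm_frob_orbit xk).
by rewrite /Fpoly; case: xgetP => [g -> //|/(_ f)[]].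
Qed.

Lemma size_Fpoly k x : x ^+ (p ^ k) = x -> size (Fpoly k x) = k.+1.
Proof.
move=> /FpolyP[_ fE]; rewrite -(size_map_poly emb) fE /frob_poly size_prod_XsubC.
by rewrite size_mkseq.
Qed.

Lemma size_rVpoly m (a : 'rV['F_p]_m) : (size (rVpoly a) <= m)%N.
Proof. exact: size_poly. Qed.

Lemma rVmonic_monic m (a : 'rV['F_p]_m) : rVmonic a \is monic.
Proof. by have [] := monic_add_Xn (size_rVpoly a). Qed.

Lemma size_rVmonic m (a : 'rV['F_p]_m) : size (rVmonic a) = m.+1.
Proof. by have [] := monic_add_Xn (size_rVpoly a). Qed.

Lemma rVmonicK m (f : {poly 'F_p}) : f \is monic -> size f = m.+1 ->
  rVmonic (poly_rV (f - 'X^m) : 'rV_m) = f.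
Proof. by move=> fm sf; rewrite /rVmonic poly_rV_K ?monic_tail // addrC subrK. Qed.

Lemma rVmonic_inj m : injective (@rVmonic m).
Proof. by move=> a b /addrI/(can_inj (@rVpolyK _ _)). Qed.

(** Division by [c] is a bijection from the monic multiples of [c] of degree [m] to the monic
    polynomials of degree [m - k]. *)
Lemma sum_multiples (c : {poly 'F_p}) k m : c \is monic -> size c = k.+1 -> (k <= m)%N ->
  \sum_(a : 'rV['F_p]_m | c %| rVmonic a) Lam (rVmonic a) = Lam c * Hsum (m - k).
Proof.
move=> cm sc km; rewrite /Hsum big_distrr /=; have c0 := monic_neq0 cm.
have sz (b : 'rV['F_p]_(m - k)) : size (c * rVmonic b) = m.+1.
  by rewrite size_monicM ?monic_neq0 ?rVmonic_monic // sc size_rVmonic addnS /= addSn subnKC.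
have mon (b : 'rV['F_p]_(m - k)) : c * rVmonic b \is monic by rewrite monicMl ?rVmonic_monic.
have dvE (a : 'rV['F_p]_m) : c %| rVmonic a ->
    rVmonic (poly_rV (rVmonic a %/ c - 'X^(m - k)) : 'rV_(m - k)) = rVmonic a %/ c.
  move=> ca; apply: rVmonicK.
    by rewrite -(monicMl _ cm) mulrC divpK // rVmonic_monic.
  by rewrite size_divp // size_rVmonic sc /= subSn.
rewrite (reindex_onto (fun b : 'rV_(m - k) => poly_rV (c * rVmonic b - 'X^m) : 'rV_m)
           (fun a => poly_rV (rVmonic a %/ c - 'X^(m - k)))) /=; last first.
  by move=> a ca; apply: rVmonic_inj; rewrite rVmonicK ?mon ?sz // dvE // mulrC divpK.
apply: eq_big => [b|b _]; last by rewrite rVmonicK ?mon ?sz // LamM ?rVmonic_monic.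
rewrite rVmonicK ?mon ?sz // dvdp_mulr // mulKp //=; apply/eqP/rVmonic_inj.
by rewrite rVmonicK ?rVmonic_monic ?size_rVmonic.
Qed.

(* Newton's identity: each monic [f] of degree [m] is counted [m] times, once for
   every pair [(k, x)] such that the [k]-th Frobenius polynomial of [x] divides [f]. *)
Lemma newton_identity m :
  m%:R * Hsum m = \sum_(1 <= k < m.+1) Ssum k * Hsum (m - k).
Proof.
rewrite /Hsum big_distrr /=.
transitivity (\sum_(a : 'rV['F_p]_m) \sum_(1 <= k < m.+1)
   \sum_(x <- Fq p K k | frob_poly p k x %| map_poly emb (rVmonic a)) Lam (rVmonic a)).
  apply: eq_bigr => a _.
  rewrite -{1}(sum_count_frob_poly p_pr emb (rVmonic_monic a) (size_rVmonic a)).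
  rewrite natr_sum big_distrl /=; apply: eq_bigr => k _.
  by rewrite big_const_seq iter_addr_0 mulr_natl.
rewrite exchange_big /= big_nat [RHS]big_nat; apply: eq_bigr => k /andP[k0].
rewrite ltnS => km.
transitivity (\sum_(x <- Fq p K k) \sum_(a : 'rV['F_p]_m | frob_poly p k x %| map_poly emb (rVmonic a))
   Lam (rVmonic a)).
  under eq_bigr do rewrite big_mkcond; rewrite exchange_big /=.
  by apply: eq_bigr => x _; rewrite [RHS]big_mkcond.
rewrite /Ssum big_distrl big_seq [RHS]big_seq /=; apply: eq_bigr => x.
rewrite (mem_Fq p_pr) // => /eqP xk; have [fm fE] := FpolyP xk.
rewrite -(sum_multiples fm (size_Fpoly xk) km); apply: eq_bigl => a.
by rewrite -fE dvdp_map.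
Qed.

End LSeries.

(** * Character sums over a prime field *)

Definition mul_nontrivial (p : nat) (C : nzRingType) (chi : 'F_p -> C) : Prop :=
  exists2 x, x != 0 & chi x != 1.

Definition add_nontrivial (p : nat) (C : nzRingType) (e : 'F_p -> C) : Prop :=
  exists x, e x != 1.

Section CharacterSums.
Variables (p : nat) (p_pr : prime p) (C : numClosedFieldType).
Implicit Types chi psi e : 'F_p -> C.

Lemma unity_norm (z : C) n : (0 < n)%N -> z ^+ n = 1 -> `|z| = 1.
Proof.
move=> n0 zn; apply/eqP; rewrite -(@pexpr_eq1 _ _ n) ?normr_ge0 //.
by rewrite -normrX zn normr1.
Qed.

Lemma Fp_expr_pred (x : 'F_p) : x != 0 -> x ^+ p.-1 = 1.
Proof.
move=> x0; apply: (mulfI x0); rewrite mulr1 -exprS prednK ?prime_gt0 //.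
by have := expf_card x; rewrite card_Fp.
Qed.

Lemma mulchar_exp chi x n : mulchar chi -> chi (x ^+ n) = chi x ^+ n.
Proof.
case=> _ chi1 chiM; elim: n => [|n IHn]; first by rewrite !expr0.
by rewrite !exprS chiM IHn.
Qed.

Lemma norm_mulchar chi x : mulchar chi -> x != 0 -> `|chi x| = 1.
Proof.
move=> chiP x0; apply: (@unity_norm _ p.-1); first by rewrite -ltnS prednK ?prime_gt0 ?prime_gt1.
by rewrite -mulchar_exp // Fp_expr_pred //; case: chiP.
Qed.

Lemma norm_mulchar_le1 chi x : mulchar chi -> `|chi x| <= 1.
Proof.
move=> chiP; have [->|x0] := eqVneq x 0; last by rewrite norm_mulchar.
by case: chiP => -> _ _; rewrite normr0 ler01.
Qed.

Lemma addcharMn e x n : addchar e -> e (x *+ n) = e x ^+ n.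
Proof.
move=> [e0 eD]; elim: n => [|n IHn]; first by rewrite mulr0n expr0.
by rewrite mulrS exprS eD IHn.
Qed.

Lemma norm_addchar e x : addchar e -> `|e x| = 1.
Proof.
move=> eP; apply: (@unity_norm _ p (prime_gt0 p_pr)); rewrite -addcharMn //.
by rewrite -mulr_natr pchar_Fp_0 // mulr0; case: eP.
Qed.

Lemma addchar_neq0 e x : addchar e -> e x != 0.
Proof. by move=> eP; rewrite -normr_eq0 norm_addchar // oner_eq0. Qed.

Lemma conj_addchar e x : addchar e -> (e x)^* = e (- x).
Proof.
move=> eP; apply: (mulfI (addchar_neq0 x eP)); rewrite -normCK norm_addchar //.
by case: eP => e0 eD; rewrite -eD subrr e0 expr1n.
Qed.

Lemma sum_mulchar chi : mulchar chi -> mul_nontrivial chi -> \sum_x chi x = 0.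
Proof.
move=> [_ _ chiM] [y y0 chiy]; apply/eqP; have: (chi y - 1) * \sum_x chi x == 0.
  rewrite mulrBl mul1r subr_eq0 big_distrr /= [X in _ == X](reindex_inj (mulfI y0)) /=.
  by apply/eqP/eq_bigr => x _; rewrite chiM.
by rewrite mulf_eq0 subr_eq0 (negPf chiy).
Qed.

Lemma sum_addchar e : addchar e -> add_nontrivial e -> \sum_x e x = 0.
Proof.
move=> [_ eD] [y ey]; apply/eqP; have: (e y - 1) * \sum_x e x == 0.
  rewrite mulrBl mul1r subr_eq0 big_distrr /= [X in _ == X](reindex_inj (addrI y)) /=.
  by apply/eqP/eq_bigr => x _; rewrite eD.
by rewrite mulf_eq0 subr_eq0 (negPf ey).
Qed.

Lemma addchar_scale e c : addchar e -> addchar (fun x => e (c * x)).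
Proof. by move=> [e0 eD]; split=> [|x y]; rewrite ?mulr0 // mulrDr eD. Qed.

Lemma add_nontrivial_scale e c : c != 0 -> add_nontrivial e ->
  add_nontrivial (fun x => e (c * x)).
Proof. by move=> c0 [y ey]; exists (c^-1 * y); rewrite mulVKf. Qed.

Lemma sum_addchar_scale e d : addchar e -> add_nontrivial e ->
  \sum_c e (c * d) = (d == 0)%:R * p%:R.
Proof.
move=> eP ent; have [->|d0] := eqVneq d 0.
  rewrite mul1r (eq_bigr (fun=> 1)) => [|c _]; last by rewrite mulr0; case: eP.
  by rewrite sumr_const card_Fp.
under eq_bigr do rewrite mulrC.
by rewrite mul0r sum_addchar //; [apply: addchar_scale | apply: add_nontrivial_scale].
Qed.

Lemma sum_normsq_mulchar chi : mulchar chi -> \sum_x `|chi x| ^+ 2 = p.-1%:R.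
Proof.
move=> chiP; rewrite (bigD1 0) //=; have [-> _ _] := chiP.
rewrite normr0 expr0n add0r (eq_bigr (fun=> 1)) => [|x x0]; last first.
  by rewrite norm_mulchar // expr1n.
rewrite sumr_const; congr (_%:R).
by have := cardC1 (0 : 'F_p); rewrite card_Fp // => <-; apply: eq_card.
Qed.

(** Orthogonality evaluates the sum of the squared moduli over all dilations of [e] as
    [p * (p - 1)]. The nonzero dilations share one modulus, and the zero one is dropped. An
    inequality is stated so as to include the trivial [chi], whose sum is [-1]. *)
Lemma gauss_sum_normsq chi e : mulchar chi -> addchar e -> add_nontrivial e ->
  `|\sum_x chi x * e x| ^+ 2 <= p%:R.
Proof.
move=> chiP eP ent; pose G c := \sum_x chi x * e (c * x).
have GE c : c != 0 -> `|G c| = `|\sum_x chi x * e x|.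
  move=> c0; have ci0 : c^-1 != 0 by rewrite invr_eq0.
  transitivity `|chi c^-1 * \sum_x chi x * e x|; last first.
    by rewrite normrM norm_mulchar // mul1r.
  rewrite /G (reindex_inj (mulfI ci0)) big_distrr /=; congr `|_|; apply: eq_bigr => x _.
  by rewrite mulVKf //; case: chiP => _ _ ->; rewrite mulrA.
have sumG : \sum_c `|G c| ^+ 2 = p%:R * p.-1%:R.
  transitivity (\sum_x \sum_y chi x * (chi y)^* * \sum_c e (c * (x - y))).
    under eq_bigr do rewrite normCK rmorph_sum /= big_distrlr /=.
    rewrite exchange_big /=; apply: eq_bigr => x _; rewrite exchange_big /=.
    apply: eq_bigr => y _; rewrite big_distrr /=; apply: eq_bigr => c _.
    by rewrite rmorphM /= (conj_addchar (c * y) eP) mulrBr; case: eP => _ ->; ring.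
  rewrite -(sum_normsq_mulchar chiP) big_distrr /=; apply: eq_bigr => x _.
  rewrite (bigD1 x) //= [X in _ + X]big1 ?addr0 => [|y yx].
    by rewrite (sum_addchar_scale _ eP ent) subrr eqxx normCK mul1r mulrC.
  by rewrite (sum_addchar_scale _ eP ent) subr_eq0 eq_sym (negPf yx) mul0r mulr0.
have p1 : 0 < p.-1%:R :> C by rewrite ltr0n -ltnS prednK ?prime_gt0 ?prime_gt1.
rewrite -(ler_pM2l p1) [leRHS]mulrC -sumG; move: GE; set S := `|_| => GE.
rewrite (bigD1 0) //= (eq_bigr (fun=> S ^+ 2)) => [|c c0]; last by rewrite GE.
rewrite sumr_const mulr_natl (_ : #|_| = p.-1) ?ler_wpDl ?exprn_ge0 //.
by have := cardC1 (0 : 'F_p); rewrite card_Fp // => <-; apply: eq_card.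
Qed.

End CharacterSums.

(** * Vanishing and size of the coefficients of the L-series *)

Section LCoefficients.
Variables (p : nat) (p_pr : prime p) (C : numClosedFieldType).
Variables (chi psi e : 'F_p -> C) (u v : 'F_p).
Hypotheses (chiP : mulchar chi) (psiP : mulchar psi) (eP : addchar e).
Hypothesis uv : u != v.

Local Notation Lam := (Lam chi psi e u v).
Local Notation Hsum := (Hsum chi psi e u v).

Lemma rVmonicD m (a : 'rV['F_p]_m) (w : {poly 'F_p}) : (size w <= m)%N ->
  rVmonic (a + poly_rV w) = rVmonic a + w.
Proof. by move=> sw; rewrite /rVmonic raddfD /= poly_rV_K // addrA. Qed.

Lemma subleadingD m (a : 'rV['F_p]_m) (w : {poly 'F_p}) : (size w <= m)%N ->
  subleading (rVmonic a + w) = subleading (rVmonic a) + ('X * w)`_m.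
Proof.
move=> sw; rewrite /rVmonic -addrA !subleadingXn ?size_rVpoly //; last first.
  by rewrite (leq_trans (size_polyD _ _)) // geq_max size_rVpoly.
by rewrite mulrDr coefD.
Qed.

Lemma Hsum_eq0_shift m (T : 'rV['F_p]_m -> 'rV['F_p]_m) (z : C) : injective T ->
  (forall a, Lam (rVmonic (T a)) = z * Lam (rVmonic a)) -> z != 1 -> Hsum m = 0.
Proof.
move=> Tinj TE z1; apply/eqP; have: (z - 1) * Hsum m == 0.
  rewrite mulrBl mul1r subr_eq0 /Hsum big_distrr /= [X in _ == X](reindex_inj Tinj) /=.
  by apply/eqP/eq_bigr => a _; rewrite TE.
by rewrite mulf_eq0 subr_eq0 (negPf z1).
Qed.

(** Adding a suitable multiple of the linear polynomial with value [1] at [x] and [0] at [y]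
    multiplies [f(x)] by [l] and keeps [f(y)]. For [1 < m] this permutes the monic polynomials of
    degree [m], and it multiplies the sum by [th l], which is not [1]. *)
Lemma Hsum_eq0_mul m (th : 'F_p -> C) (x y : 'F_p) : mulchar th -> mul_nontrivial th ->
  (1 < m)%N -> x != y ->
  (forall (a : 'rV['F_p]_m) (w : {poly 'F_p}) s t, size w = 2%N -> w.[x] = 1 -> w.[y] = 0 ->
   (rVmonic a).[x] + s = t * (rVmonic a).[x] ->
   Lam (rVmonic a + s *: w) = th t * Lam (rVmonic a)) ->
  Hsum m = 0.
Proof.
move=> thP [l l0 thl] m1 xy LE; pose w : {poly 'F_p} := (x - y)^-1 *: ('X - y%:P).
have xy0 : x - y != 0 by rewrite subr_eq0.
have sw : size w = 2%N by rewrite size_scale ?invr_eq0 // size_XsubC.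
have wx : w.[x] = 1 by rewrite /w !hornerE mulVf.
have wy : w.[y] = 0 by rewrite /w !hornerE subrr mulr0.
move: w sw wx wy => w sw wx wy.
pose s (a : 'rV['F_p]_m) := (l - 1) * (rVmonic a).[x].
have szs a : (size (s a *: w) <= m)%N by rewrite (leq_trans (size_scale_leq _ _)) ?sw.
apply: (@Hsum_eq0_shift m (fun a : 'rV_m => a + poly_rV (s a *: w)) (th l)) => // [a b ab|a].
  have sE a0 : (rVmonic (a0 + poly_rV (s a0 *: w))).[x] = l * (rVmonic a0).[x].
    by rewrite rVmonicD // hornerD hornerZ wx mulr1 /s mulrBl mul1r addrC subrK.
  have := congr1 (fun c => (rVmonic c).[x]) ab; rewrite /= !sE => /(mulfI l0) eab.
  by move: ab; rewrite /s eab => /addIr.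
by rewrite rVmonicD //; apply: LE => //; rewrite /s mulrBl mul1r addrC subrK.
Qed.

(** A linear correction touches the coefficient of degree [m - 1] only when [m = 2], whence the
    alternative between [2 < m] and a trivial [e]. *)
Lemma Hsum_eq0_mulchar m : (1 < m)%N -> (2 < m)%N \/ (forall x, e x = 1) ->
  mul_nontrivial chi \/ mul_nontrivial psi -> Hsum m = 0.
Proof.
move=> m1 me nt.
have eE (a : 'rV['F_p]_m) (w : {poly 'F_p}) s : size w = 2%N ->
    e (subleading (rVmonic a + s *: w)) = e (subleading (rVmonic a)).
  move=> sw; case: me => [m2|e1]; last by rewrite !e1.
  have sw' : (size (s *: w) <= 2)%N by rewrite -sw size_scale_leq.
  rewrite subleadingD ?(leq_trans sw') // coefXM gtn_eqF ?(ltn_trans _ m2) //.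
  rewrite nth_default ?addr0 // (leq_trans sw') // -ltnS prednK //.
  exact: ltn_trans m2.
have [_ _ chiM] := chiP; have [_ _ psiM] := psiP; case: nt => nt.
  apply: (Hsum_eq0_mul chiP nt m1 uv) => a w s t sw wx wy ft.
  by rewrite /Lam eE // !(hornerD (rVmonic a)) !hornerZ wx wy mulr1 mulr0 addr0 ft chiM; ring.
have vu : v != u by rewrite eq_sym.
apply: (Hsum_eq0_mul psiP nt m1 vu) => a w s t sw wx wy ft.
by rewrite /Lam eE // !(hornerD (rVmonic a)) !hornerZ wx wy mulr1 mulr0 addr0 ft psiM; ring.
Qed.

(** A monic polynomial of degree [m - 1] divisible by [('X - u%:P) * ('X - v%:P)] exists from
    [m = 3] on; adding its multiples moves the subleading coefficient and keeps the values at [u]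
    and [v]. *)
Lemma Hsum_eq0_addchar m : (2 < m)%N -> add_nontrivial e -> Hsum m = 0.
Proof.
case: m => [|[|[|m]]] // _ [c ec].
pose w : {poly 'F_p} := ('X - u%:P) * (('X - v%:P) * 'X^m).
have wm : w \is monic by rewrite !monicMl ?monicXsubC ?monicXn.
have sw : size w = m.+3.
  by rewrite /w !size_monicM ?monicXsubC ?monic_neq0 ?monicMl ?monicXsubC ?monicXn // !size_XsubC size_polyXn.
have wu : w.[u] = 0 by rewrite /w hornerM hornerXsubC subrr mul0r.
have wv : w.[v] = 0 by rewrite /w !hornerM !hornerXsubC subrr mul0r mulr0.
have scw : (size (c *: w) <= m.+3)%N by rewrite -sw size_scale_leq.
apply: (@Hsum_eq0_shift _ (fun a : 'rV_m.+3 => a + poly_rV (c *: w)) (e c)) => // [a b|a].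
  exact: addIr.
have wl : w`_m.+2 = 1 by move/monicP: wm; rewrite lead_coefE sw.
rewrite rVmonicD // /Lam subleadingD // coefXM /= coefZ wl mulr1.
rewrite !(hornerD (rVmonic a)) !hornerZ wu wv !mulr0 !addr0.
by case: eP => _ ->; ring.
Qed.

Lemma Hsum0 : Hsum 0 = 1.
Proof.
rewrite /Hsum (bigD1 0) //= big1 ?addr0 => [|a]; last first.
  by rewrite (thinmx0 a) eqxx.
have [_ chi1 _] := chiP; have [_ psi1 _] := psiP; have [e0 _] := eP.
have -> : rVmonic (0 : 'rV['F_p]_0) = 1 by rewrite /rVmonic raddf0 addr0.
have s1 : subleading (1 : {poly 'F_p}) = 0.
  by rewrite /subleading mulr1 size_poly1 coefX.
by rewrite /Lam s1 !hornerE chi1 psi1 e0 !mulr1.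
Qed.

Lemma Hsum1 : Hsum 1 = \sum_x chi (u - x) * psi (v - x) * e (- x).
Proof.
rewrite /Hsum (reindex (fun x : 'F_p => - x%:M : 'rV_1)) /=; last first.
  exists (fun a : 'rV_1 => - a 0 0) => [x _|a _]; first by rewrite !mxE eqxx opprK.
  by apply/rowP=> i; rewrite !ord1 !mxE eqxx opprK.
apply: eq_bigr => x _.
have -> : rVmonic (- x%:M : 'rV_1) = 'X - x%:P.
  by rewrite /rVmonic raddfN /= [x%:M]mx11_scalar mxE eqxx -/(_%:M);
    congr ('X - _); apply/polyP=> i; rewrite coef_rVpoly coefC;
    case: insubP => [j _ <-|]; rewrite ?ord1 ?mxE //; case: i.
by rewrite /Lam !hornerXsubC /subleading size_XsubC /= coefXM /= coefB coefX coefC sub0r.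
Qed.

(** The terms [x = u] and [x = v] vanish. Both are needed: with only one of them removed, the later
    comparison with [p] would not be strict. *)
Lemma norm_Hsum1 : `|Hsum 1| <= p.-2%:R.
Proof.
rewrite Hsum1 (bigD1 u) //= (bigD1 v) //=; last by rewrite eq_sym.
have [chi0 _ _] := chiP; have [psi0 _ _] := psiP.
rewrite !subrr chi0 psi0 !(mul0r, mulr0) !add0r (le_trans (ler_norm_sum _ _ _)) //.
rewrite (@le_trans _ _ (\sum_(x : 'F_p | (x != u) && (x != v)) 1)) //.
  apply: ler_sum => x _; rewrite !normrM (norm_addchar p_pr _ eP) mulr1.
  by rewrite mulr_ile1 ?normr_ge0 ?norm_mulchar_le1.
rewrite sumr_const ler_nat; set A := #|_|.
have : (A + #|pred2 u v| = p)%N.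
  rewrite -[RHS](card_Fp p_pr) -(cardC (pred2 u v)) addnC; congr (_ + _)%N.
  by apply: eq_card => x; rewrite !inE negb_or.
by rewrite card2 uv; lia.
Qed.

Definition interp (ab : 'F_p * 'F_p) : {poly 'F_p} :=
  ('X - u%:P) * ('X - v%:P) + ((ab.1 / (u - v))%:P * ('X - v%:P) + (ab.2 / (v - u))%:P * ('X - u%:P)).

(** By Lagrange interpolation a monic quadratic is given by its values at [u] and [v], and its
    subleading coefficient is affine in these values. The sum therefore splits into a product of two
    Gauss sums. *)
Lemma norm_Hsum2 : add_nontrivial e -> `|Hsum 2| <= p%:R.
Proof.
move=> ent; have uv0 : u - v != 0 by rewrite subr_eq0.
have szl (ab : 'F_p * 'F_p) :
    (size ((ab.1 / (u - v))%:P * ('X - v%:P) + (ab.2 / (v - u))%:P * ('X - u%:P))%R < 3)%N.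
  rewrite ltnS (leq_trans (size_polyD _ _)) // geq_max !mul_polyC.
  by rewrite !(leq_trans (size_scale_leq _ _)) // size_XsubC.
have szq : size (('X - u%:P) * ('X - v%:P)) = 3%N.
  by rewrite size_monicM ?monicXsubC ?monic_neq0 ?monicXsubC // !size_XsubC.
have im ab : interp ab \is monic.
  by rewrite monicE lead_coefDl ?szq ?szl // -monicE monicMl ?monicXsubC.
have isz ab : size (interp ab) = 3%N by rewrite /interp size_polyDl ?szq ?szl.
have vu0 : v - u != 0 by rewrite -opprB oppr_eq0.
have iu ab : (interp ab).[u] = ab.1.
  rewrite /interp !hornerD !hornerM !hornerC !hornerXsubC subrr.
  by rewrite mul0r mulr0 addr0 add0r divfK.
have iv ab : (interp ab).[v] = ab.2.
  rewrite /interp !hornerD !hornerM !hornerC !hornerXsubC subrr.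
  by rewrite !mulr0 !add0r divfK.
have sub_interp ab :
    subleading (interp ab) = - (u + v) + (u - v)^-1 * ab.1 + (- (u - v)^-1) * ab.2.
  rewrite /subleading isz /= coefXM /= /interp mulrBl !coefD !coefN coefXM !coefCM.
  rewrite !coefB !coefX !coefC /= -[v - u]opprB invrN !subr0 !mulr1 sub0r -opprD [v + u]addrC.
  by rewrite -addrA [ab.1 / _]mulrC [ab.2 * _]mulrC.
pose h ab : 'rV_2 := poly_rV (interp ab - 'X^2).
have hE ab : rVmonic (h ab) = interp ab by rewrite rVmonicK.
have hinj : injective h.
  move=> [a b] [a' b'] /(congr1 (@rVmonic p 2)); rewrite !hE => ab.
  have := congr1 (horner^~ u) ab; have := congr1 (horner^~ v) ab.
  by rewrite /= !iu !iv /= => -> ->.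
have hbij : bijective h.
  apply: inj_card_bij => //; rewrite card_mx card_prod.
  by rewrite expnE.
have [e0 eD] := eP.
have -> : Hsum 2 = e (- (u + v)) * ((\sum_x chi x * e ((u - v)^-1 * x)) *
                                   (\sum_y psi y * e (- (u - v)^-1 * y))).
  rewrite /Hsum (reindex h) /=; last exact: onW_bij.
  rewrite big_distrlr /= pair_big big_distrr /=; apply: eq_bigr => [[a b]] _.
  by rewrite hE /Lam iu iv sub_interp !eD /=; ring.
have ui0 : (u - v)^-1 != 0 by rewrite invr_eq0.
rewrite normrM (norm_addchar p_pr _ eP) mul1r -(@ler_pXn2r _ 2) ?nnegrE ?normr_ge0 ?ler0n //.
rewrite normrM exprMn [leRHS]expr2 ler_pM ?exprn_ge0 //.
  by apply: gauss_sum_normsq => //; [apply: addchar_scale | apply: add_nontrivial_scale].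
apply: gauss_sum_normsq => //; first exact: addchar_scale.
by apply: add_nontrivial_scale => //; rewrite oppr_eq0.
Qed.

End LCoefficients.

Definition nontrivial_triple (p : nat) (C : nzRingType) (chi psi e : 'F_p -> C) : Prop :=
  [\/ mul_nontrivial chi, mul_nontrivial psi | add_nontrivial e].

(** * Reciprocal roots of the L-polynomial *)

Section PowerSums.
Variables (p : nat) (p_pr : prime p) (K : closedFieldType) (emb : {rmorphism 'F_p -> K}).
Variables (C : numClosedFieldType) (chi psi e : 'F_p -> C) (u v : 'F_p).
Hypotheses (chiP : mulchar chi) (psiP : mulchar psi) (eP : addchar e).
Hypotheses (uv : u != v) (nt : nontrivial_triple chi psi e).

Local Notation Hsum := (Hsum chi psi e u v).
Local Notation Ssum := (Ssum emb chi psi e u v).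

Lemma nontrivial_cases : add_nontrivial e \/
  ((forall x, e x = 1) /\ (mul_nontrivial chi \/ mul_nontrivial psi)).
Proof.
have [[x ex]|e1] := pselect (add_nontrivial e); first by left; exists x.
right; split=> [x|]; last by case: nt => [h|h|/e1 []]; [left|right].
by apply/eqP/negP => ex; apply: e1; exists x; apply/negP.
Qed.

Lemma Hsum_ge3 m : (2 < m)%N -> Hsum m = 0.
Proof.
move=> m2; case: nontrivial_cases => [ent|[e1 mnt]]; first exact: Hsum_eq0_addchar.
by apply: Hsum_eq0_mulchar => //; [exact: ltnW | right].
Qed.

Lemma norm_Hsum2_le : `|Hsum 2| <= p%:R.
Proof.
case: nontrivial_cases => [ent|[e1 mnt]]; first exact: norm_Hsum2.
by rewrite Hsum_eq0_mulchar ?normr0 ?ler0n //; right.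
Qed.

Lemma Ssum1 : Ssum 1 = Hsum 1.
Proof.
have := newton_identity p_pr emb u v chiP psiP eP 1.
by rewrite big_nat1 subnn Hsum0 // mulr1 mul1r => ->.
Qed.

Lemma Ssum2 : Ssum 2 = 2%:R * Hsum 2 - Hsum 1 ^+ 2.
Proof.
rewrite (newton_identity p_pr emb u v chiP psiP eP 2).
by rewrite big_ltn // big_nat1 subnn Hsum0 // Ssum1; ring.
Qed.

Lemma Ssum_rec m : Ssum m.+3 = - (Ssum m.+2 * Hsum 1) - Ssum m.+1 * Hsum 2.
Proof.
have := newton_identity p_pr emb u v chiP psiP eP m.+3.
rewrite Hsum_ge3 // mulr0 big_nat_recr //= big_nat_recr //= big_nat_recr //=.
rewrite big_nat big1 => [|k /andP[_ km]]; last first.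
  by rewrite Hsum_ge3 ?mulr0 // -ltnS -subSn; lia.
have -> : (m.+3 - m.+1 = 2)%N by lia.
have -> : (m.+3 - m.+2 = 1)%N by lia.
by rewrite subnn Hsum0 // => /eqP; rewrite eq_sym => /eqP h; rewrite -[LHS]subr0 -h; ring.
Qed.

Lemma Ssum_power_sums : exists a b : C,
  [/\ a + b = - Hsum 1, a * b = Hsum 2 & forall m, (0 < m)%N -> Ssum m = - (a ^+ m + b ^+ m)].
Proof.
(* [X^2 + Hsum 1 * X + Hsum 2] is the reversed L-polynomial; [a] and [b] are its roots. *)
have [a ra] := solve_monicpoly (fun i => if i == 0%N then - Hsum 2 else - Hsum 1) (isT : (0 < 2)%N).
pose b := - Hsum 1 - a; move: ra; rewrite !big_ord_recl big_ord0 /= => ra.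
have ab : a + b = - Hsum 1 by rewrite /b; ring.
have mab : a * b = Hsum 2.
  by rewrite /b mulrBr -expr2 ra; rewrite expr0 expr1; ring.
have H1 : Hsum 1 = - (a + b) by rewrite ab opprK.
exists a, b; split=> // m m0.
suff: Ssum m = - (a ^+ m + b ^+ m) /\ Ssum m.+1 = - (a ^+ m.+1 + b ^+ m.+1) by case.
elim: m m0 => [//|[|m] IHm] _.
  rewrite Ssum2 Ssum1 -mab H1; split; ring.
have [//|IH1 IH2] := IHm; split=> //.
by rewrite Ssum_rec IH1 IH2 -mab H1 !exprS; ring.
Qed.

(* If [p <= `|a|] then [`|b| <= 1], so [p - 1 <= `|a + b|], which exceeds the trivial
   bound [p - 2] for [Hsum 1]. *)
Lemma power_sum_roots_lt (a b : C) : a + b = - Hsum 1 -> a * b = Hsum 2 -> `|a| < p%:R.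
Proof.
move=> ab mab; have p0 : 0 < p%:R :> C by rewrite ltr0n prime_gt0.
rewrite real_ltNge ?normr_real ?realn //; apply/negP => pa.
have b1 : `|b| <= 1.
  rewrite -(ler_pM2l p0) mulr1 (le_trans _ norm_Hsum2_le) // -mab normrM.
  by rewrite ler_wpM2r.
have h1 : `|a + b| <= p.-2%:R by rewrite ab normrN norm_Hsum1.
have : p%:R <= p.-2%:R + 1 :> C.
  rewrite (le_trans pa) // -[a](addrK b) (le_trans (ler_normB _ _)) //.
  exact: lerD.
by rewrite natr1 ler_nat; have := prime_gt1 p_pr; lia.
Qed.

End PowerSums.

(** * Stepanov's method *)

Lemma poly_family_dependent (K : fieldType) (T : finType) (P : T -> {poly K}) N :
  (forall t, (size (P t) <= N)%N) -> (N < #|T|)%N ->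
  exists2 b : T -> K, exists t, b t != 0 & \sum_t b t *: P t = 0.
Proof.
move=> szP ltN; pose M : 'M[K]_(#|T|, N) := \matrix_(i, j) (P (enum_val i))`_j.
have: kermx M != 0.
  rewrite kermx_eq0 /row_free neq_ltn (leq_ltn_trans (rank_leq_col M)) //.
case/rowV0Pn=> w /sub_kermxP wM /rV0Pn[i wi].
exists (fun t => w 0 (enum_rank t)); first by exists (enum_val i); rewrite enum_valK.
apply/polyP=> j; rewrite coef0 coef_sum; have [jN|Nj] := ltnP j N; last first.
  by rewrite big1 // => t _; rewrite coefZ nth_default ?mulr0 // (leq_trans (szP t)).
have := congr1 (fun A : 'rV_N => A 0 (Ordinal jN)) wM; rewrite !mxE => wMj.
rewrite -[RHS]wMj (reindex_onto enum_val enum_rank) /= => [|t _]; last exact: enum_rankK.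
apply: eq_big => [k|k _]; first by rewrite enum_valK eqxx.
by rewrite coefZ enum_valK mxE.
Qed.

(** Serves twice, with the two index ranges exchanged: for the degree of [Phi] and for that of
    [Psi]. *)
Lemma degree_bound q a j w b J D : (0 < q)%N -> (a < b)%N -> (j < J)%N -> (w <= D.+1)%N ->
  (q * a + j + w <= q * b + J + D)%N.
Proof. by move=> q0 ab jJ wD; have := leq_mul (leqnn q) ab; rewrite mulnS; lia. Qed.

Section Stepanov.
Variables (p : nat) (p_pr : prime p) (K : closedFieldType) (charK : p \in [pchar K]).
Variables (mu : nat) (I : finType) (Cl : Type).
Variables (theta : I -> {poly K}) (om : {poly K}) (phi : Cl -> I -> {poly K}) (B : Cl -> seq K).
Variables (D J b : nat).
Local Notation Q := (p ^ mu)%N.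
Hypothesis theta_size : forall s, (size (theta s) <= D.+1)%N.
Hypothesis phi_size : forall c s, (size (phi c s) <= D.+1)%N.
Hypothesis B_uniq : forall c, uniq (B c).
(** On a class, [theta s ^+ Q], of large degree, agrees up to the nonvanishing factor [om] with
    [phi c s], of small degree. The method exploits this collapse. *)
Hypothesis BP : forall c x, x \in B c ->
  [/\ x ^+ (p ^ (mu + mu)) = x, om.[x] != 0 &
      forall s, om.[x] * (theta s).[x] ^+ Q = (phi c s).[x]].
Hypothesis phi_free : forall E : I -> {poly K},
  (forall c, \sum_s E s * phi c s = 0) -> forall s, E s = 0.
Hypothesis B_large : forall c, (Q * b + J + D < size (B c))%N.
Hypothesis enough : (Q * b + J + D < #|I| * J * b)%N.
Hypothesis J_small : (J <= Q)%N.

(* The auxiliary polynomial [Psi] vanishes on the class [c]. It is nonzero because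
   otherwise the same coefficients would kill the functions [phi c'] on every class
   [c'], each of which has more points than the degree involved. *)
Lemma stepanov_bound c : (size (B c) <= b + Q * J + D)%N.
Proof.
pose T : finType := (I * ('I_J * 'I_b))%type.
pose mon (t : T) : {poly K} := 'X^(Q * t.2.2 + t.2.1).
have Phi_size c' (t : T) : (size (mon t * phi c' t.1)%R <= Q * b + J + D)%N.
  apply: (leq_trans (size_polyMleq _ _)); rewrite size_polyXn addSn /=.
  by apply: degree_bound; rewrite ?expn_gt0 ?prime_gt0 ?ltn_ord.
have cardT : (Q * b + J + D < #|{: T}|)%N by rewrite !card_prod !card_ord mulnA.
have [w [t0 wt0] wPhi] := poly_family_dependent (Phi_size c) cardT.
(* [Psi] carries [Q]-th roots of the coefficients, so that its [Q]-th power has the coefficients [w]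
   themselves. *)
have rootQ (z : K) : exists y, y ^+ Q = z.
  have Q0 : (0 < Q)%N by rewrite expn_gt0 prime_gt0.
  have [y yP] := solve_monicpoly (fun i => if i == 0%N then z else 0) Q0.
  exists y; rewrite yP -(prednK Q0) big_ord_recl /= mulr1 big1 ?addr0 // => i _.
  by rewrite mul0r.
have [r rP] := choice (fun t => rootQ (w t)).
pose Psi : {poly K} := \sum_(t : T) r t *: ('X^(t.2.2 + Q * t.2.1) * theta t.1).
pose Phi c' : {poly K} := \sum_(t : T) w t *: (mon t * phi c' t.1).
(* Since [x ^+ (Q * Q) = x], the [Q]-th power of [x ^+ (a + Q * j)] is [x ^+ (Q * a + j)]: the two
   digits of the exponent are exchanged. *)
have PsiPhi c' x : x \in B c' -> om.[x] * Psi.[x] ^+ Q = (Phi c').[x].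
  case/BP=> xq _ xth.
  have xqq : x ^+ Q ^+ Q = x by rewrite -exprM -expnD.
  have xE a j : x ^+ (a + Q * j) ^+ Q = x ^+ (Q * a + j).
    rewrite !exprD exprMn -(exprM x a) [(a * _)%N]mulnC; congr (_ * _).
    by rewrite -exprM mulnAC !exprM xqq.
  rewrite /Psi /Phi !horner_sum expr_sum_pk // big_distrr /=.
  apply: eq_bigr => t _; rewrite /mon !hornerZ !hornerM !hornerXn -xth !exprMn rP.
  by rewrite xE; ring.
have [Psi0|Psi0] := eqVneq Psi 0; last first.
  have szPsi : (size Psi <= b + Q * J + D)%N.
    apply: (leq_trans (size_sum _ _ _)); apply/bigmax_leqP => t _.
    apply: (leq_trans (size_scale_leq _ _)); apply: (leq_trans (size_polyMleq _ _)).
    rewrite size_polyXn addSn /=.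
    have Q0 : (0 < Q)%N by rewrite expn_gt0 prime_gt0.
    have := degree_bound Q0 (ltn_ord t.2.1) (ltn_ord t.2.2) (theta_size t.1).
    by rewrite ![(Q * _ + _)%N]addnC.
  apply: leq_trans szPsi; apply/ltnW/max_poly_roots => //; apply/allP => x xB.
  have [_ omx _] := BP xB; have := PsiPhi c x xB; rewrite /Phi wPhi horner0 => /eqP.
  by rewrite mulf_eq0 (negPf omx) expf_eq0 => /andP[].
have Phi0 c' : Phi c' = 0.
  apply/eqP; apply: contraT => Pc'; have := B_large c'; rewrite ltnNge => /negP[].
  apply: leq_trans (_ : (size (Phi c') <= _)%N); last first.
    apply: (leq_trans (size_sum _ _ _)); apply/bigmax_leqP => t _.
    exact: leq_trans (size_scale_leq _ _) (Phi_size c' t).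
  apply/ltnW/max_poly_roots => //; apply/allP => x xB.
  by rewrite rootE -PsiPhi // Psi0 horner0 expr0n expn_eq0 -leqn0 leqNgt prime_gt0 ?mulr0 ?eqxx.
pose E s : {poly K} := \sum_(ja : 'I_J * 'I_b) w (s, ja) *: mon (s, ja).
have E0 : forall s, E s = 0.
  apply: phi_free => c'; rewrite -[RHS](Phi0 c') /Phi /E.
  under eq_bigr do rewrite big_distrl /=.
  by rewrite pair_big /=; apply: eq_bigr => -[s ja] _; rewrite -scalerAl.
(* The exponents [Q * a + j] with [j < J <= Q] are pairwise distinct, so the nonzero [w] found above
   is a coefficient of [E s]. *)
case: t0 wt0 => s [j0 a0] /eqP[]; have := congr1 (fun g : {poly K} => g`_(Q * a0 + j0)) (E0 s).
rewrite coef0 /E coef_sum (bigD1 (j0, a0)) //= big1 ?addr0 => [|[j a] ne].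
  by rewrite coefZ coefXn eqxx mulr1.
rewrite coefZ coefXn /=; case: eqP => [eqn|]; last by rewrite mulr0.
have Q0 : (0 < Q)%N by rewrite expn_gt0 prime_gt0.
have jQ (i : 'I_J) : (i < Q)%N by rewrite (leq_trans (ltn_ord i)).
have ea : a0 = a.
  apply: val_inj; have := congr1 (divn^~ Q) eqn; rewrite /= !(mulnC Q) !divnMDl //.
  by rewrite !divn_small ?addn0.
case/eqP: ne; move: eqn; rewrite ea => /addnI/val_inj ->; done.
Qed.

End Stepanov.

(* Here [M] is the number of classes and [Q * Q] the size of the field; the second
   conjunct says that there are more coefficients than linear conditions. *)
Lemma stepanov_parameters (M Q : nat) : (1 < M)%N -> (68 * M <= Q)%N -> exists b J : nat,
  [/\ (J <= Q)%N, (Q * b + J + 3 * Q < M * J * b)%N,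
      (forall n, Q * Q <= 2 * M * n -> Q * b + J + 3 * Q < n)%N &
      (M * (b + Q * J + 3 * Q) <= Q * Q + 38 * M * Q)%N].
Proof.
(* [M * J] exceeds [Q] by at least [33 * M], so [M * J * b] exceeds [Q * b] by at least
   [33 * M * b], roughly [8 * Q], which beats [J + 3 * Q <= 4 * Q]. The [4] in [b] keeps the degree
   near [Q ^ 2 / (4 * M)], below the size [Q ^ 2 / (2 * M)] granted to each class. *)
move=> M1 MQ; exists (Q %/ (4 * M))%N, (Q %/ M + 34)%N.
set b := (Q %/ (4 * M))%N; set J := (_ + 34)%N.
have M0 : (0 < M)%N by rewrite ltnW.
have bE : Q = (4 * M * b + Q %% (4 * M))%N by rewrite {1}(divn_eq Q (4 * M)) -/b mulnC.
have br : (Q %% (4 * M) < 4 * M)%N by rewrite ltn_mod muln_gt0.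
have JE : (Q + 34 * M = M * J + Q %% M)%N.
  by rewrite /J {1}(divn_eq Q M) [(M * _)%N]mulnC mulnDl addnAC.
have Jr : (Q %% M < M)%N by rewrite ltn_mod.
move: (Q %% _)%N (Q %% _)%N br bE Jr JE => r s br bE Jr JE.
have JQ : (J <= Q)%N.
  have : (2 * J <= M * J)%N by rewrite leq_mul2r M1 orbT.
  by clear -JE MQ M1; lia.
have bQ : (4 * M * b <= Q)%N by rewrite bE leq_addr.
have bQ' : (Q < 4 * M * b + 4 * M)%N by rewrite bE ltn_add2l.
have MJ : (M * J <= Q + 34 * M)%N by rewrite JE leq_addr.
have MJ' : (Q + 33 * M <= M * J)%N by clear -JE Jr; lia.
split=> //.
- apply: leq_trans (leq_mul MJ' (leqnn b)); rewrite mulnDl.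
  have -> : (33 * M * b = 8 * (4 * M * b) + M * b)%N by lia.
  by move: (4 * M * b)%N bQ bQ' (M * b)%N (Q * b)%N => x xQ Qx y z; lia.
- move=> n Qn; have := leq_mul (leqnn Q) bQ.
  have -> : (Q * (4 * M * b) = 4 * M * (Q * b))%N by lia.
  rewrite ltnNge => h1; apply/negP => h2.
  have : (4 * M * n <= 4 * M * (Q * b) + 4 * M * (4 * Q))%N.
    by rewrite -mulnDr leq_mul2l; apply/orP; right; lia.
  have : (68 * M * Q <= Q * Q)%N by rewrite leq_mul2r MQ orbT.
  have : (0 < M * Q)%N by rewrite muln_gt0 M0; lia.
  move: Qn h1.
  have -> : (4 * M * n = 2 * (2 * M * n))%N by lia.
  have -> : (4 * M * (4 * Q) = 16 * (M * Q))%N by lia.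
  have -> : (68 * M * Q = 68 * (M * Q))%N by lia.
  by move: (2 * M * n)%N (4 * M * (Q * b))%N (M * Q)%N (Q * Q)%N => x y z t; lia.
(* [38 = 34 + 3 + 1]: the excess of [M * J] over [Q], the summand [3 * Q], and [M * b], which is at
   most [Q]. *)
- have -> : (M * (b + Q * J + 3 * Q) = M * b + Q * (M * J) + 3 * (M * Q))%N by lia.
  have h := leq_mul (leqnn Q) MJ; have := leq_add h (leqnn (M * b + 3 * (M * Q))%N).
  have MQ' : (Q <= M * Q)%N by rewrite leq_pmull.
  move: bQ h; have -> : (Q * (Q + 34 * M) = Q * Q + 34 * (M * Q))%N by lia.
  have -> : (4 * M * b = 4 * (M * b))%N by lia.
  have -> : (38 * M * Q = 38 * (M * Q))%N by lia.
  by move: (M * b)%N (Q * (M * J))%N (M * Q)%N (Q * Q)%N MQ' => x y z t; lia.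
Qed.

(** The [a i] are the coefficients of a polynomial of degree below [n] with [n] distinct roots. It
    is applied with [R] the ring [{poly K}] itself. *)
Lemma vandermonde_free (R : idomainType) (T : finType) (S : {pred T}) (f : T -> R) n (a : 'I_n -> R) :
  injective f -> (n <= #|S|)%N ->
  (forall t, t \in S -> \sum_i a i * f t ^+ i = 0) -> forall i, a i = 0.
Proof.
move=> finj nS root_a i; pose P := \sum_i a i *: 'X^i : {poly R}.
have szP : (size P <= n)%N.
  apply: (leq_trans (size_sum _ _ _)); apply/bigmax_leqP => j _.
  by rewrite (leq_trans (size_scale_leq _ _)) // size_polyXn.
have P0 : P = 0.
  apply/eqP; apply: contraT => Pn0.
  have: (size [seq f t | t <- enum S] < size P)%N.
    apply: max_poly_roots => //; last by rewrite map_inj_uniq ?enum_uniq.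
    apply/allP => _ /mapP[t tS ->]; rewrite mem_enum in tS.
    rewrite rootE /P horner_sum -[X in _ == X](root_a t tS); apply/eqP/eq_bigr => j _.
    by rewrite hornerZ hornerXn.
  by rewrite size_map -cardE ltnNge (leq_trans szP nS).
have := congr1 (fun g : {poly R} => g`_i) P0; rewrite coef0 /P coef_sum (bigD1 i) //= big1.
  by rewrite addr0 coefZ coefXn eqxx mulr1.
move=> j ji; rewrite coefZ coefXn; case: eqP => [e|]; last by rewrite mulr0.
by case/eqP: ji; apply: val_inj.
Qed.

Lemma sum_triple (V : nmodType) (T1 T2 T3 : finType) (F : T1 * T2 * T3 -> V) :
  \sum_s F s = \sum_l \sum_k \sum_i F (i, k, l).
Proof.
transitivity (\sum_(ik : T1 * T2) \sum_l F (ik, l)).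
  by rewrite (pair_bigA _ (fun ik l => F (ik, l))); apply: eq_bigr => -[].
rewrite exchange_big; apply: eq_bigr => l _.
transitivity (\sum_i \sum_k F (i, k, l)); last by rewrite exchange_big.
by rewrite (pair_bigA _ (fun i k => F (i, k, l))); apply: eq_bigr => -[].
Qed.

(** * Classes of given norms and trace *)

Section Classes.
Variables (p : nat) (p_pr : prime p) (K : closedFieldType) (emb : {rmorphism 'F_p -> K}).
Variables (u v : 'F_p) (mu : nat).
Hypothesis mu0 : (0 < mu)%N.
Local Notation Q := (p ^ mu)%N.
Local Notation m := (mu + mu)%N.

Definition frob_class k (c : 'F_p * 'F_p * 'F_p) : seq K :=
  [seq x <- Fq p K k | [&& (Fpoly emb k x).[u] == c.1.1, (Fpoly emb k x).[v] == c.1.2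
                         & subleading (Fpoly emb k x) == c.2]].

(* On the field with [Q * Q] elements, [w * w ^+ Q] is the norm of [emb a - X] for
   [w := half_norm a], and [h + h ^+ Q] is the trace of [X] for [h := half_trace]. *)
Definition half_norm (a : 'F_p) : {poly K} := ((emb a)%:P - 'X) ^+ (\sum_(i < mu) p ^ i)%N.
Definition half_trace : {poly K} := \sum_(i < mu) 'X^(p ^ i).

(** The exponent in [half_norm] is [(Q - 1) / (p - 1)], so the degree stays below [Q]. *)
Lemma size_half_norm a i : (i < p.-1)%N -> (size (half_norm a ^+ i) <= Q)%N.
Proof.
move=> ip; rewrite -exprM; apply: leq_trans (size_poly_exp_leq _ _) _.
rewrite -[_ - 'X]opprB size_polyN size_XsubC /= mul1n.
have Q0 : (0 < Q)%N by rewrite expn_gt0 prime_gt0.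
rewrite -(prednK Q0) ltnS predn_exp [in leqRHS]mulnC leq_mul2l; apply/orP; right; exact: ltnW.
Qed.

Lemma size_half_trace : (size half_trace <= (p ^ mu.-1).+1)%N.
Proof.
apply: (leq_trans (size_sum _ _ _)); apply/bigmax_leqP => j _.
by rewrite size_polyXn ltnS leq_pexp2l ?prime_gt0 // -ltnS prednK.
Qed.

(** The degree is at most [p ^ mu.-1 * p.-1 = Q - p ^ mu.-1]. *)
Lemma size_exp_small (f : {poly K}) i : (size f <= (p ^ mu.-1).+1)%N -> (i < p)%N ->
  (size (f ^+ i) <= Q)%N.
Proof.
move=> szf ip; apply: leq_trans (size_poly_exp_leq _ _) _; have p0 := prime_gt0 p_pr.
have h1 : ((size f).-1 * i <= p ^ mu.-1 * p.-1)%N.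
  by apply: leq_mul; [rewrite -subn1 leq_subLR add1n | rewrite -ltnS prednK].
have <- : (p ^ mu.-1 * p.-1 + p ^ mu.-1 = Q)%N by rewrite -mulnSr prednK // -expnSr prednK.
apply: leq_trans (_ : (p ^ mu.-1 * p.-1).+1 <= _)%N => //.
by rewrite -addn1 leq_add2l expn_gt0 p0.
Qed.

Lemma half_normE a x : (half_norm a).[x] = \prod_(i < mu) (emb a - x) ^+ (p ^ i).
Proof. by rewrite /half_norm horner_exp hornerD hornerN hornerC hornerX prodrXr. Qed.

(** The first [mu] of the [2 * mu] conjugate factors multiply to [half_norm], the others to its
    [Q]-th power. *)
Lemma Fpoly_eval x a : x ^+ (p ^ m) = x ->
  emb (Fpoly emb m x).[a] = (half_norm a).[x] * (half_norm a).[x] ^+ Q.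
Proof.
move=> xm; have [_ fE] := FpolyP p_pr emb xm.
rewrite -horner_map fE /frob_poly /frob_orbit /mkseq big_map horner_prod half_normE.
rewrite -prodrXl (_ : iota 0 m = index_iota 0 m) ?big_mkord ?big_split_ord /=;
  last by rewrite /index_iota subn0.
have embB k : emb a - x ^+ (p ^ k) = (emb a - x) ^+ (p ^ k).
  by rewrite exprB_pk ?(pchar_K p_pr emb) // (embXp p_pr).
by congr (_ * _); apply: eq_bigr => i _; rewrite hornerXsubC embB //= -exprM -expnD addnC.
Qed.

Lemma Fpoly_subleading x : x ^+ (p ^ m) = x ->
  emb (subleading (Fpoly emb m x)) = - (half_trace.[x] + half_trace.[x] ^+ Q).
Proof.
move=> xm; have [_ fE] := FpolyP p_pr emb xm.
have m0 : (0 < m)%N by rewrite addn_gt0 mu0.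
rewrite /subleading (size_Fpoly p_pr emb xm) coefXM gtn_eqF // -coef_map fE /=.
have -> : (m.-1 = (size (frob_orbit p m x)).-1)%N by rewrite size_mkseq.
rewrite /frob_poly coefPn_prod_XsubC ?size_mkseq -?lt0n //; congr (- _).
rewrite /frob_orbit /mkseq big_map (_ : iota 0 m = index_iota 0 m) ?big_mkord ?big_split_ord /=;
  last by rewrite /index_iota subn0.
rewrite /half_trace horner_sum expr_sum_pk ?(pchar_K p_pr emb) //.
congr (_ + _); apply: eq_bigr => i _; rewrite hornerXn //.
by rewrite -exprM -expnD addnC.
Qed.

(** On a class [A * A ^+ Q] is the constant [c.1.1], so [A ^+ p.-2] turns [A ^+ (i * Q)] into a
    constant times [A ^+ (p.-2 - i)]; similarly for [B], while [h ^+ Q = - c.2 - h]. Nonzero norms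
    make [om] nonvanishing, and [3 * Q] accounts for three factors of degree below [Q]. *)
Lemma frob_class_bound (b J : nat) :
  (forall c : 'F_p * 'F_p * 'F_p, c.1.1 != 0 -> c.1.2 != 0 ->
     (Q * b + J + 3 * Q < size (frob_class m c))%N) ->
  (Q * b + J + 3 * Q < (p.-1 * p.-1 * p) * J * b)%N -> (J <= Q)%N ->
  forall c : 'F_p * 'F_p * 'F_p, c.1.1 != 0 -> c.1.2 != 0 ->
    (size (frob_class m c) <= b + Q * J + 3 * Q)%N.
Proof.
move=> large enough JQ c c1 c2.
have p0 := prime_gt0 p_pr; have charK := pchar_K p_pr emb.
have m0 : (0 < m)%N by rewrite addn_gt0 mu0.
pose I : finType := ('I_p.-1 * 'I_p.-1 * 'I_p)%type.
pose Cl := {c : 'F_p * 'F_p * 'F_p | (c.1.1 != 0) && (c.1.2 != 0)}.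
pose A := half_norm u; pose B := half_norm v; pose h := half_trace.
pose theta (s : I) := A ^+ s.1.1 * B ^+ s.1.2 * h ^+ s.2.
pose om := A ^+ p.-2 * B ^+ p.-2.
pose ec (a : 'F_p) : {poly K} := (emb a)%:P.
pose phi (c : Cl) (s : I) := ec (val c).1.1 ^+ s.1.1 * ec (val c).1.2 ^+ s.1.2 *
  (A ^+ (p.-2 - s.1.1) * B ^+ (p.-2 - s.1.2) * (- ec (val c).2 - h) ^+ s.2).
have c12 : (c.1.1 != 0) && (c.1.2 != 0) by rewrite c1 c2.
have size3 (f g k : {poly K}) : (size f <= Q -> size g <= Q -> size k <= Q ->
    size (f * g * k)%R <= (3 * Q).+1)%N.
  move=> sf sg sk; rewrite (leq_trans (size_polyMleq _ _)) //.
  by have := size_polyMleq f g; lia.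
have sub_lt (i : nat) : (p.-2 - i < p.-1)%N.
  by rewrite (leq_ltn_trans (leq_subr _ _)) // prednK // -ltnS prednK // prime_gt1.
(* Three nested Vandermonde arguments: over the [p] values of the third coordinate, then over the
   [p - 1] nonzero values of each norm. *)
have phi_free (E : I -> {poly K}) : (forall c0, \sum_s E s * phi c0 s = 0) -> forall s, E s = 0.
  move=> E0; have ec_inj : injective ec by move=> a a' /polyC_inj/(fmorph_inj emb).
  have A0 i : A ^+ i != 0.
    by rewrite expf_neq0 // /A /half_norm expf_neq0 // -oppr_eq0 opprB polyXsubC_eq0.
  have B0 i : B ^+ i != 0.
    by rewrite expf_neq0 // /B /half_norm expf_neq0 // -oppr_eq0 opprB polyXsubC_eq0.
  have card_units : (p.-1 <= #|[pred a : 'F_p | a != 0%R]|)%N.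
    rewrite (_ : #|_| = p.-1) //.
    by have := cardC1 (0 : 'F_p); rewrite card_Fp // => <-; apply: eq_card.
  pose E3 (a d : 'F_p) (l : 'I_p) : {poly K} := \sum_k (\sum_i E (i, k, l) * A ^+ (p.-2 - i) * ec a ^+ i)
     * B ^+ (p.-2 - k) * ec d ^+ k.
  have E3_0 a d l : a != 0 -> d != 0 -> E3 a d l = 0.
    move=> a0 d0; move: l.
    have inj3 : injective (fun t : 'F_p => - ec t - h) by move=> t t' /addIr/oppr_inj/ec_inj.
    apply: (@vandermonde_free _ 'F_p predT (fun t => - ec t - h) p) => //.
      by rewrite card_Fp.
    move=> t _; have abt : ((a, d, t).1.1 != 0) && ((a, d, t).1.2 != 0) by rewrite /= a0 d0.
    rewrite -[RHS](E0 (exist _ (a, d, t) abt)) sum_triple /=.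
    apply: eq_bigr => l _; rewrite /E3 big_distrl /=; apply: eq_bigr => k _.
    rewrite 2!big_distrl big_distrl /=; apply: eq_bigr => i _.
    by rewrite /phi /=; ring.
  have E2_0 a k l : a != 0 -> \sum_i E (i, k, l) * A ^+ (p.-2 - i) * ec a ^+ i = 0.
    move=> a0; apply: (mulIf (B0 (p.-2 - k)%N)); rewrite mul0r; move: k.
    apply: (@vandermonde_free _ 'F_p [pred z | z != 0%R] ec) => // t t0.
    exact: (E3_0 a t l).
  move=> [[i k] l]; apply: (mulIf (A0 (p.-2 - i)%N)); rewrite mul0r; move: i.
  apply: (@vandermonde_free _ 'F_p [pred z | z != 0%R] ec) => // t t0.
  exact: (E2_0 t k l).
have theta_size s : (size (theta s) <= (3 * Q).+1)%N.
  by apply: size3; rewrite ?size_half_norm ?size_exp_small ?size_half_trace ?ltn_ord.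
have sizeZ (z : K) (f : {poly K}) N : (size f <= N)%N -> (size (z%:P * f)%R <= N)%N.
  by move=> fN; rewrite mul_polyC (leq_trans (size_scale_leq _ _)).
have phi_size c0 s : (size (phi c0 s) <= (3 * Q).+1)%N.
  rewrite /phi -!rmorphXn -rmorphM /=; apply: sizeZ; apply: size3.
  - by rewrite size_half_norm ?sub_lt.
  - by rewrite size_half_norm ?sub_lt.
  - apply: size_exp_small => //; rewrite -opprD size_polyN (leq_trans (size_polyD _ _)) //.
    by rewrite geq_max size_half_trace (leq_trans (size_polyC_leq1 _)).
have := @stepanov_bound p p_pr K charK mu I Cl theta om phi (fun c => frob_class m (val c))
  (3 * Q) J b theta_size phi_size _ _ phi_free _ _ JQ (exist _ c c12).
apply=> [c0|c0 x|[c0 c0P]|] /=.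
- exact/filter_uniq/(uniq_Fq p_pr emb).
- rewrite mem_filter (mem_Fq p_pr) // => /andP[/and3P[/eqP xu /eqP xv /eqP xs] /eqP xm].
  have := Fpoly_eval u xm; have := Fpoly_eval v xm; have := Fpoly_subleading xm.
  rewrite xu xv xs -/A -/B -/h => hs hB hA; have /andP[c01 c02] := valP c0.
  have Ax0 : A.[x] != 0.
    by apply: contraNneq c01 => Ax; rewrite -(fmorph_eq0 emb) hA Ax mul0r.
  have Bx0 : B.[x] != 0.
    by apply: contraNneq c02 => Bx; rewrite -(fmorph_eq0 emb) hB Bx mul0r.
  clearbody A B h; split=> // [|[[i k] l]]; first by rewrite /om hornerM !horner_exp mulf_neq0 ?expf_neq0.
  have hQ : h.[x] ^+ Q = - emb (val c0).2 - h.[x] by rewrite hs; ring.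
  have le_p2 (j : 'I_p.-1) : (j <= p.-2)%N by rewrite -ltnS prednK // -ltnS prednK // prime_gt1.
  have exp_split (y : K) (j : 'I_p.-1) : y ^+ p.-2 = y ^+ (p.-2 - j) * y ^+ j.
    by rewrite -exprD subnK.
  rewrite /om /theta /phi !hornerM !horner_exp !hornerD !hornerN !hornerC /= hA hB -hQ.
  rewrite (exp_split A.[x] i) (exp_split B.[x] k) !exprMn.
  by rewrite -!exprM !(mulnC Q) !exprM; ring.
- by have /andP[] := c0P; apply: large.
- by rewrite !card_prod !card_ord.
Qed.

End Classes.

(** * The Weil bound *)

Section ComplexModulus.
Variable R : realType.
Implicit Types z w : R[i].

Lemma normC_cabs z : `|z| = (cabs z)%:C%C.
Proof. by rewrite /cabs normc_def. Qed.

Lemma cabs_eq z (x : R) : `|z| = x%:C%C -> cabs z = x.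
Proof. by rewrite /cabs => ->. Qed.

Lemma cabs_ge0 z : 0 <= cabs z.
Proof. by rewrite -lecR -normC_cabs normr_ge0. Qed.

Lemma cabsM z w : cabs (z * w) = cabs z * cabs w.
Proof. by apply: cabs_eq; rewrite normrM !normC_cabs -rmorphM. Qed.

Lemma cabsX z k : cabs (z ^+ k) = cabs z ^+ k.
Proof. by apply: cabs_eq; rewrite normrX normC_cabs -rmorphXn. Qed.

Lemma cabsN z : cabs (- z) = cabs z.
Proof. by rewrite /cabs normrN. Qed.

Lemma cabs_nat k : cabs (k%:R : R[i]) = k%:R.
Proof. by apply: cabs_eq; rewrite normr_nat rmorph_nat. Qed.

Lemma cabs_conj z : cabs z^* = cabs z.
Proof. by rewrite /cabs norm_conjC. Qed.

Lemma cabs0 : cabs (0 : R[i]) = 0.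
Proof. exact: (cabs_nat 0). Qed.

Lemma cabs_norm1 z : `|z| = 1 -> cabs z = 1.
Proof. by move=> z1; apply: cabs_eq. Qed.

Lemma cabsD z w : cabs (z + w) <= cabs z + cabs w.
Proof. by rewrite -lecR rmorphD -!normC_cabs ler_normD. Qed.

Lemma cabs_sum I (r : seq I) (P : pred I) (F : I -> R[i]) :
  cabs (\sum_(i <- r | P i) F i) <= \sum_(i <- r | P i) cabs (F i).
Proof.
by rewrite -lecR rmorph_sum -normC_cabs (le_trans (ler_norm_sum _ _ _)).
Qed.

Lemma cabs_le_nat z k : `|z| <= k%:R -> cabs z <= k%:R.
Proof. by rewrite -lecR rmorph_nat -normC_cabs. Qed.

Lemma cabs_lt_nat z k : `|z| < k%:R -> cabs z < k%:R.
Proof. by rewrite -ltcR rmorph_nat -normC_cabs. Qed.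

Lemma bernoulli_ineq (t : R) k : 0 <= t -> 1 + k%:R * t <= (1 + t) ^+ k.
Proof.
move=> t0; elim: k => [|k IHk]; first by rewrite mul0r addr0 expr0.
rewrite exprS (le_trans _ (ler_wpM2l _ IHk)) ?addr_ge0 // -natr1.
have : 0 <= k%:R * t * t by rewrite !mulr_ge0.
by lra.
Qed.

Lemma expr_unbounded (x B : R) : 1 < x -> exists k0, forall k, (k0 <= k)%N -> B < x ^+ k.
Proof.
move=> x1; pose t := x - 1; have t0 : 0 < t by rewrite subr_gt0.
exists (Num.bound (`|B| / t)) => k kk.
have := @archi_boundP R (`|B| / t) (divr_ge0 (normr_ge0 _) (ltW t0)).
rewrite ltr_pdivrMr // => hB.
have h1 : (Num.bound (`|B| / t))%:R * t <= k%:R * t by rewrite ler_pM2r // ler_nat.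
have := bernoulli_ineq k (ltW t0); rewrite [1 + t]addrC subrK => hb.
have hn := ler_norm B; move: hB h1 hb hn; set y := _ * t; set z := _ * t; lra.
Qed.

Lemma expr_small (x d : R) : 0 <= x -> x < 1 -> 0 < d ->
  exists k0, forall k, (k0 <= k)%N -> x ^+ k < d.
Proof.
move=> x0 x1 d0; have [->|xn0] := eqVneq x 0.
  by exists 1%N => -[|k] // _; rewrite expr0n.
have xp : 0 < x by rewrite lt0r xn0.
have [|k0 k0P] := @expr_unbounded x^-1 d^-1; first by rewrite invf_gt1.
by exists k0 => k /k0P; rewrite exprVn ltf_pV2 // posrE // exprn_gt0.
Qed.

End ComplexModulus.

(** * Characters built from a primitive root *)

Section DiscreteLog.
Variables (p : nat) (p_pr : prime p) (al : 'F_p) (al_prim : p.-1.-primitive_root al).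

(** The default [0] occurs at [x = 0], which [pow_char] and [pers] treat apart. *)
Definition dlog (x : 'F_p) : nat := odflt 0%N (omap val [pick i : 'I_p.-1 | x == al ^+ i]).

Lemma dlogK x : x != 0 -> al ^+ dlog x = x.
Proof.
move=> x0; rewrite /dlog; case: pickP => [i /eqP -> //|noi].
have [i xi] := prim_rootP al_prim (Fp_expr_pred p_pr x0).
by have := noi i; rewrite xi eqxx.
Qed.

Lemma prim_al_neq0 : al != 0.
Proof.
apply/eqP => a0; have := prim_expr_order al_prim; rewrite a0.
by rewrite expr0n; case: (p.-1) (prim_order_gt0 al_prim) => // n _ /eqP; rewrite eq_sym oner_eq0.
Qed.

Lemma dlog_exp (C : nzRingType) (w : C) k : w ^+ p.-1 = 1 -> w ^+ dlog (al ^+ k) = w ^+ k.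
Proof.
move=> wp; have al0 : al ^+ k != 0 by rewrite expf_neq0 // prim_al_neq0.
have /eqP := dlogK al0; rewrite (eq_prim_root_expr al_prim) => /eqP dk.
by rewrite -(expr_mod _ wp) dk expr_mod.
Qed.

Definition pow_char (C : nzRingType) (w : C) (x : 'F_p) : C :=
  if x == 0 then 0 else w ^+ dlog x.

Lemma pow_char_exp (C : nzRingType) (w : C) k : w ^+ p.-1 = 1 ->
  pow_char w (al ^+ k) = w ^+ k.
Proof. by move=> wp; rewrite /pow_char expf_eq0 (negPf prim_al_neq0) andbF dlog_exp. Qed.

Lemma pow_char_mulchar (C : nzRingType) (w : C) : w ^+ p.-1 = 1 -> mulchar (pow_char w).
Proof.
move=> wp; split; first by rewrite /pow_char eqxx.
  by have := pow_char_exp 0 wp; rewrite !expr0.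
move=> x y; have [->|x0] := eqVneq x 0; first by rewrite /pow_char mul0r eqxx mul0r.
have [->|y0] := eqVneq y 0; first by rewrite /pow_char mulr0 eqxx mulr0.
by rewrite -(dlogK x0) -(dlogK y0) -exprD !pow_char_exp // exprD.
Qed.

Lemma pow_char_nontrivial (C : nzRingType) (w : C) : w ^+ p.-1 = 1 -> w != 1 ->
  mul_nontrivial (pow_char w).
Proof.
move=> wp w1; exists al; first exact: prim_al_neq0.
by rewrite -[al]expr1 pow_char_exp.
Qed.

End DiscreteLog.

Lemma prim_root_exists (C : numClosedFieldType) n : (0 < n)%N ->
  exists w : C, n.-primitive_root w.
Proof.
move=> n0; have [r rP] := closed_field_poly_normal ('X^n - 1 : {poly C}).
have mon : ('X^n - 1 : {poly C}) \is monic by rewrite monicXnsubC.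
rewrite (monicP mon) scale1r in rP.
have : has n.-primitive_root r; last by case/hasP=> w _ wP; exists w.
apply: has_prim_root => //.
- apply/allP => z zr; rewrite unity_rootE -subr_eq0.
  by have := root_prod_XsubC r z; rewrite -rP rootE !hornerE zr => ->.
- rewrite -separable_prod_XsubC -rP; apply: separable_Xn_sub_1.
  by rewrite pnatr_eq0 -lt0n.
- by have := size_XnsubC (1 : C) n0; rewrite rP size_prod_XsubC => -[->].
Qed.

Lemma sum_prim_root (C : fieldType) n (w : C) (d : nat) : n.-primitive_root w ->
  \sum_(i < n) (w ^+ d) ^+ i = ((n %| d)%N)%:R * n%:R.
Proof.
move=> wP; have n0 := prim_order_gt0 wP; rewrite (prim_order_dvd wP).
have [->|wd] := eqVneq (w ^+ d) 1.
  by rewrite mul1r (eq_bigr (fun=> 1)) => [|i _]; rewrite ?expr1n // sumr_const card_ord.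
rewrite mul0r; apply/eqP; have: (w ^+ d - 1) * \sum_(i < n) (w ^+ d) ^+ i == 0.
  by rewrite -subrX1 -exprM mulnC exprM (prim_expr_order wP) expr1n subrr.
by rewrite mulf_eq0 subr_eq0 (negPf wd).
Qed.

Definition root_addchar (p : nat) (C : nzRingType) (z : C) (x : 'F_p) : C := z ^+ x.

Lemma root_addchar_addchar p (C : nzRingType) (z : C) : prime p -> z ^+ p = 1 ->
  addchar (@root_addchar p C z).
Proof.
move=> p_pr zp; split=> [|x y]; first by rewrite /root_addchar expr0.
have zE : z ^+ (Zp_trunc (pdiv p)).+2 = 1 by rewrite pdiv_id // Zp_cast ?prime_gt1.
by rewrite /root_addchar -exprD /= expr_mod.
Qed.

Lemma root_addchar_nontrivial p (C : nzRingType) (z : C) : prime p -> z != 1 ->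
  add_nontrivial (@root_addchar p C z).
Proof.
move=> p_pr z1; exists 1; rewrite /root_addchar /=.
by have -> : (1 %% (Zp_trunc (pdiv p)).+2 = 1)%N by [].
Qed.

(** * From weak equidistribution to the Weil bound *)

Section Equidistribution.
Variables (R : realType) (p : nat) (p_pr : prime p).
Variables (K : closedFieldType) (emb : {rmorphism 'F_p -> K}).
Variables (al : 'F_p) (al_prim : p.-1.-primitive_root al).
Variables (u v : 'F_p) (uv : u != v).
Local Notation C := R[i].
Local Notation M := (p.-1 * p.-1 * p)%N.
Local Notation T := ('I_p.-1 * 'I_p.-1 * 'F_p)%type.

Lemma pred_prime_gt0 : (0 < p.-1)%N.
Proof. by rewrite -ltnS prednK ?prime_gt0 ?prime_gt1. Qed.

Lemma Ssum_decay (chi psi e : 'F_p -> C) (d : R) : mulchar chi -> mulchar psi -> addchar e ->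
  nontrivial_triple chi psi e -> 0 < d ->
  exists k0, forall k, (k0 <= k)%N -> (0 < k)%N ->
    cabs (Ssum emb chi psi e u v k) <= d * p%:R ^+ k.
Proof.
move=> chiP psiP eP nt d0.
have [a [b [ab mab SE]]] := Ssum_power_sums p_pr emb chiP psiP eP uv nt.
have la := cabs_lt_nat (power_sum_roots_lt p_pr chiP psiP eP uv nt ab mab).
have lb : cabs b < p%:R.
  by apply: cabs_lt_nat; apply: (power_sum_roots_lt p_pr chiP psiP eP uv nt) (a) _ _; rewrite 1?addrC 1?mulrC.
have p0 : 0 < p%:R :> R by rewrite ltr0n prime_gt0.
have small z : cabs z < p%:R -> exists k0, forall k, (k0 <= k)%N -> cabs z ^+ k <= d / 2%:R * p%:R ^+ k.
  move=> zp; have [|||k0 k0P] := @expr_small R (cabs z / p%:R) (d / 2%:R).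
  - by rewrite divr_ge0 ?cabs_ge0 // ltW.
  - by rewrite ltr_pdivrMr // mul1r.
  - by rewrite divr_gt0.
  exists k0 => k /k0P; rewrite expr_div_n ltr_pdivrMr ?exprn_gt0 //; exact: ltW.
have [ka kaP] := small a la; have [kb kbP] := small b lb.
exists (maxn ka kb) => k; rewrite geq_max => /andP[ak bk] k0.
rewrite SE // cabsN (le_trans (cabsD _ _)) // !cabsX.
by have := kaP k ak; have := kbP k bk; lra.
Qed.

Section Fourier.
Variables (w z : C) (wP : p.-1.-primitive_root w) (zP : p.-primitive_root z).

Let chi_ (i : 'I_p.-1) := pow_char al (w ^+ i).
Let e_ (l : 'F_p) := fun x : 'F_p => root_addchar z (l * x).

Let chi_mulchar i : mulchar (chi_ i).
Proof. by apply: pow_char_mulchar => //; rewrite exprAC (prim_expr_order wP) expr1n. Qed.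

Let z_neq1 : z != 1.
Proof.
rewrite -[z]expr1 -(prim_order_dvd zP) dvdn1; apply/eqP => p1.
by have := prime_gt1 p_pr; rewrite p1.
Qed.

Let e_addchar l : addchar (e_ l).
Proof. by apply/addchar_scale/root_addchar_addchar => //; exact: prim_expr_order. Qed.

Lemma mulchar_orthogonality x c : c != 0 ->
  \sum_i chi_ i x * (chi_ i c)^* = (x == c)%:R * p.-1%:R.
Proof.
move=> c0; have [->|x0] := eqVneq x 0.
  rewrite eq_sym (negPf c0) mul0r big1 // => i _.
  by have [-> _ _] := chi_mulchar i; rewrite mul0r.
have y0 : x / c != 0 by rewrite mulf_neq0 ?invr_eq0.
transitivity (\sum_i chi_ i (x / c)).
  apply: eq_bigr => i _; have [_ _ chiM] := chi_mulchar i.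
  rewrite -{1}(divfK c0 x) (chiM (x / c)) -mulrA -normCK (norm_mulchar p_pr (chi_mulchar i) c0).
  by rewrite expr1n mulr1.
rewrite /chi_ /pow_char (negPf y0).
under eq_bigr do rewrite exprAC; rewrite (sum_prim_root _ wP).
rewrite (prim_order_dvd al_prim) dlogK //; congr (_%:R * _); congr nat_of_bool.
by rewrite -subr_eq0 -(inj_eq (mulIf c0)) mulrBl mul0r divfK // mul1r subr_eq0.
Qed.

Lemma addchar_orthogonality x c : \sum_l e_ l x * (e_ l c)^* = (x == c)%:R * p%:R.
Proof.
have eP : addchar (@root_addchar p C z) by apply: root_addchar_addchar => //; exact: prim_expr_order.
rewrite -subr_eq0 -(sum_addchar_scale p_pr _ eP (root_addchar_nontrivial p_pr z_neq1)).
apply: eq_bigr => l _; rewrite (conj_addchar p_pr c (e_addchar l)) /e_.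
by case: eP => _ <-; rewrite mulrN -mulrBr.
Qed.

Lemma frob_class_fourier k (c : 'F_p * 'F_p * 'F_p) : c.1.1 != 0 -> c.1.2 != 0 ->
  M%:R * (size (frob_class emb u v k c))%:R =
  \sum_(t : T) (chi_ t.1.1 c.1.1 * chi_ t.1.2 c.1.2 * e_ t.2 c.2)^*
     * Ssum emb (chi_ t.1.1) (chi_ t.1.2) (e_ t.2) u v k :> C.
Proof.
move=> c1 c2; rewrite /Ssum /frob_class size_filter -sum1_count natr_sum big_distrr /=.
under [RHS]eq_bigr do rewrite big_distrr /=.
rewrite exchange_big /= big_mkcond /=; apply: eq_bigr => x _.
set f := Fpoly emb k x.
transitivity ((\sum_i chi_ i f.[u] * (chi_ i c.1.1)^*) *
              (\sum_j chi_ j f.[v] * (chi_ j c.1.2)^*) *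
              (\sum_l e_ l (subleading f) * (e_ l c.2)^*)).
  rewrite !mulchar_orthogonality // addchar_orthogonality.
  by do 3![case: eqP => _] => /=; rewrite ?mul0r ?mulr0 ?mul0r ?mul1r ?mulr1 -?natrM.
rewrite big_distrlr /= pair_bigA /= big_distrlr /= pair_bigA /=.
apply: eq_bigr => [[[i j] l]] _ /=.
by rewrite /Lam !rmorphM /=; ring.
Qed.

(** Frobenius is injective and fixes the prime field, so a characteristic polynomial vanishing at
    [emb a] belongs to [emb a] itself; only [emb u] and [emb v] are lost. *)
Lemma trivial_Ssum_ge (chi psi e : 'F_p -> C) k : (0 < k)%N ->
  (forall x, chi x = (x != 0)%:R) -> (forall x, psi x = (x != 0)%:R) -> (forall x, e x = 1) ->
  exists2 n0, Ssum emb chi psi e u v k = n0%:R & (p ^ k <= n0 + 2)%N.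
Proof.
move=> k0 chiE psiE eE; pose P x := (Fpoly emb k x).[u] * (Fpoly emb k x).[v] != 0.
exists (count P (Fq p K k)).
  rewrite /Ssum -sum1_count natr_sum [RHS]big_mkcond /=; apply: eq_bigr => x _.
  by rewrite /Lam chiE psiE eE /P mulr1 mulf_eq0 negb_or; do 2![case: eqP => _];
    rewrite /= ?mulr0 ?mul0r ?mulr1.
rewrite -(size_Fq p_pr K k0) -(count_predC P) leq_add2l -size_filter.
apply: (@uniq_leq_size _ _ [:: emb u; emb v]); first exact/filter_uniq/(uniq_Fq p_pr emb).
move=> x; rewrite mem_filter /= negbK !inE => /andP[]; rewrite (mem_Fq p_pr) // => fx /eqP xk.
have [_ fE] := FpolyP p_pr emb xk.
have rootE a : (Fpoly emb k x).[a] = 0 -> x = emb a.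
  move=> fa; have: root (map_poly emb (Fpoly emb k x)) (emb a).
    by rewrite rootE horner_map fa rmorph0.
  rewrite fE /frob_poly root_prod_XsubC => /mapP[i _].
  by rewrite -{1}(embXp p_pr emb a i) => /(expr_pk_inj p_pr emb).
by move: fx; rewrite mulf_eq0 => /orP[] /eqP /rootE ->; rewrite eqxx ?orbT.
Qed.

(** The trivial triple contributes at least [p ^ k - 2], and the others, at most [p ^ k / (4 * M)]
    each, together at most [p ^ k / 4]. From [k = 3] on [p ^ k >= 8], so the lost [2] is also at
    most [p ^ k / 4], and half of [p ^ k] remains. *)
Lemma frob_class_lower : exists k0, forall k, (k0 <= k)%N ->
  forall c : 'F_p * 'F_p * 'F_p, c.1.1 != 0 -> c.1.2 != 0 ->
     (p ^ k <= 2 * M * size (frob_class emb u v k c))%N.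
Proof.
have M0 : (0 < M)%N by rewrite !muln_gt0 pred_prime_gt0 prime_gt0.
pose i0 := Ordinal pred_prime_gt0; pose t0 : T := (i0, i0, 0).
pose d : R := (4 * M)%:R^-1.
have d0 : 0 < d by rewrite invr_gt0 ltr0n muln_gt0.
have Md : M%:R * d = 4^-1.
  by rewrite /d (natrM _ 4) invfM mulrCA divff ?mulr1 // pnatr_eq0 -lt0n.
pose S (t : T) k := Ssum emb (chi_ t.1.1) (chi_ t.1.2) (e_ t.2) u v k.
have w_neq1 (i : 'I_p.-1) : i != i0 -> w ^+ i != 1.
  move=> ii0; rewrite -(prim_order_dvd wP) gtnNdvd ?ltn_ord // lt0n.
  by apply: contraNneq ii0 => i00; apply/eqP/val_inj.
have w_pow (i : 'I_p.-1) : (w ^+ i) ^+ p.-1 = 1.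
  by rewrite exprAC (prim_expr_order wP) expr1n.
have decay t : exists k0, t != t0 -> forall k, (k0 <= k)%N -> (0 < k)%N ->
    cabs (S t k) <= d * p%:R ^+ k.
  have [->|tt0] := eqVneq t t0; first by exists 0%N.
  have nt : nontrivial_triple (chi_ t.1.1) (chi_ t.1.2) (e_ t.2).
    have [ti|ti] := eqVneq t.1.1 i0; last first.
      by apply: Or31; apply: pow_char_nontrivial => //; apply: w_neq1.
    have [tj|tj] := eqVneq t.1.2 i0; last first.
      by apply: Or32; apply: pow_char_nontrivial => //; apply: w_neq1.
    apply: Or33; apply: add_nontrivial_scale; last exact: root_addchar_nontrivial.
    by apply: contraNneq tt0 => tl; case: t ti tj tl => [[i j] l] /= -> -> ->.
  have [k0 k0P] := Ssum_decay (chi_mulchar _) (chi_mulchar _) (e_addchar _) nt d0.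
  by exists k0.
have [kk kkP] := choice decay.
exists (maxn 3 (\max_t kk t)) => k; rewrite geq_max => /andP[k3 kmax] c c1 c2.
have k0 : (0 < k)%N by apply: leq_trans k3.
have chi0 x : chi_ i0 x = (x != 0)%:R by rewrite /chi_ /pow_char expr0 expr1n; case: eqP.
have e0 x : e_ 0 x = 1 by rewrite /e_ /root_addchar mul0r expr0.
have [n0 n0E n0P] := trivial_Ssum_ge k0 chi0 chi0 e0.
have := frob_class_fourier k c1 c2; rewrite (bigD1 t0) //= !chi0 c1 c2 e0 n0E.
rewrite !mulr1 rmorph1 mul1r -natrM; set X := (M * _)%N; set E := \sum_(_ | _) _ => XE.
have E_le : cabs E <= p%:R ^+ k / 4.
  rewrite (le_trans (cabs_sum _ _ _)) //.
  apply: (@le_trans _ _ (\sum_(t : T | t != t0) d * p%:R ^+ k)).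
    apply: ler_sum => t tt0; rewrite cabsM cabs_conj !cabsM.
    rewrite (cabs_norm1 (norm_mulchar p_pr (chi_mulchar _) c1)).
    rewrite (cabs_norm1 (norm_mulchar p_pr (chi_mulchar _) c2)).
    rewrite (cabs_norm1 (norm_addchar p_pr _ (e_addchar _))) !mul1r.
    by apply: (kkP t tt0 k) => //; apply: leq_trans kmax; apply: leq_bigmax.
  rewrite (@le_trans _ _ (\sum_(t : T) d * p%:R ^+ k)) //.
    rewrite [leRHS](bigD1 t0) //= lerDr mulr_ge0 ?ltW //.
    by rewrite exprn_gt0 // ltr0n prime_gt0.
  rewrite sumr_const !card_prod !card_ord /= pdiv_id // Zp_cast ?prime_gt1 //.
  by rewrite -[leLHS]mulr_natl mulrA Md mulrC.
have n0X : n0%:R <= X%:R + p%:R ^+ k / 4 :> R.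
  have : n0%:R = X%:R - E :> C by rewrite XE addrK.
  move/(congr1 (@cabs R)); rewrite cabs_nat => ->.
  by rewrite (le_trans (cabsD _ _)) // cabsN cabs_nat lerD2l.
have pk8 : (8 <= p ^ k)%N.
  apply: (@leq_trans (p ^ 3)); last by rewrite leq_pexp2l ?prime_gt0.
  by rewrite -[8%N]/(2 ^ 3)%N leq_exp2r // prime_gt1.
rewrite -mulnA -/X -(ler_nat R) natrM natrX; move: n0P pk8.
rewrite -(ler_nat R) natrD natrX -(ler_nat R) natrX => n0P pk8.
by move: n0X n0P pk8; set q := p%:R ^+ k; lra.
Qed.

End Fourier.

Definition valid_class : {pred 'F_p * 'F_p * 'F_p} := fun c => (c.1.1 != 0) && (c.1.2 != 0).

Lemma Ssum_classes (chi psi e : 'F_p -> C) k : mulchar chi -> mulchar psi ->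
  Ssum emb chi psi e u v k = \sum_(c in valid_class)
     chi c.1.1 * psi c.1.2 * e c.2 * (size (frob_class emb u v k c))%:R.
Proof.
move=> [chi0 _ _] [psi0 _ _]; rewrite /Ssum /frob_class.
under [RHS]eq_bigr do rewrite size_filter -sum1_count natr_sum big_distrr /= big_mkcond /=.
rewrite exchange_big /=; apply: eq_bigr => x _; set f := Fpoly emb k x.
pose c0 := (f.[u], f.[v], subleading f).
have other c : c != c0 -> [&& f.[u] == c.1.1, f.[v] == c.1.2 & subleading f == c.2] = false.
  apply: contraNF => /and3P[/eqP fu /eqP fv /eqP fs].
  by rewrite /c0 fu fv fs; case: c {fu fv fs} => [[]].
have [vc|nvc] := boolP (c0 \in valid_class).
  rewrite (bigD1 c0) //= !eqxx mulr1 big1 ?addr0 // => c /andP[_ cc0].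
  by rewrite other.
rewrite big1 => [|c vc]; last first.
  by rewrite other //; apply: contraNneq nvc => <-.
move: nvc; rewrite unfold_in /valid_class negb_and !negbK => /orP[] /eqP /= h.
  by rewrite /Lam -/f h chi0 !mul0r.
by rewrite /Lam -/f h psi0 mulr0 mul0r.
Qed.

Lemma card_valid_class : #|valid_class| = M.
Proof.
have unitsE : #|[pred a : 'F_p | a != 0]| = p.-1.
  by have := cardC1 (0 : 'F_p); rewrite card_Fp // => <-; apply: eq_card.
transitivity #|[predX [predX [pred a : 'F_p | a != 0] & [pred a : 'F_p | a != 0]] & predT : pred 'F_p]|.
  by apply: eq_card => c; rewrite !inE /= andbT.
by rewrite !cardX unitsE; congr (_ * _)%N; exact: card_Fp.
Qed.

Lemma sum_valid_class (chi psi e : 'F_p -> C) : mulchar chi -> mulchar psi -> addchar e ->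
  nontrivial_triple chi psi e ->
  \sum_(c in valid_class) chi c.1.1 * psi c.1.2 * e c.2 = 0.
Proof.
move=> chiP psiP eP nt; rewrite big_mkcond /=.
transitivity (\sum_(c : 'F_p * 'F_p * 'F_p) chi c.1.1 * psi c.1.2 * e c.2).
  apply: eq_bigr => c _; case: ifPn => //; rewrite unfold_in negb_and !negbK.
  have [chi0 _ _] := chiP; have [psi0 _ _] := psiP.
  by case/orP => /eqP ->; rewrite ?chi0 ?psi0 ?(mul0r, mulr0) ?mul0r.
transitivity ((\sum_x chi x) * (\sum_x psi x) * (\sum_x e x)).
  by rewrite big_distrlr /= pair_bigA /= big_distrlr /= pair_bigA.
case: nt => nt; first by rewrite (sum_mulchar chiP nt) !mul0r.
  by rewrite (sum_mulchar psiP nt) mulr0 mul0r.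
by rewrite (sum_addchar eP nt) mulr0.
Qed.

Lemma Ssum_weil (chi psi e : 'F_p -> C) : mulchar chi -> mulchar psi -> addchar e ->
  nontrivial_triple chi psi e ->
  exists mu0, forall mu, (mu0 <= mu)%N ->
    cabs (Ssum emb chi psi e u v (mu + mu)) <= (40 * M)%:R * p%:R ^+ mu.
Proof.
move=> chiP psiP eP nt; have p1 := prime_gt1 p_pr; have p'0 := pred_prime_gt0.
have M1 : (1 < M)%N by rewrite (leq_trans p1) // leq_pmull // muln_gt0 p'0.
have [w wP] := prim_root_exists C p'0.
have [z zP] := prim_root_exists C (prime_gt0 p_pr).
have [k0 k0P] := frob_class_lower wP zP.
exists (maxn k0 (68 * M)) => mu; rewrite geq_max => /andP[kmu Mmu].
have M0n : (0 < M)%N by exact: ltnW.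
have mu0 : (0 < mu)%N by apply: leq_trans Mmu; rewrite muln_gt0 M0n.
set Q := (p ^ mu)%N; pose N c := size (frob_class emb u v (mu + mu) c).
have MQ : (68 * M <= Q)%N by rewrite (leq_trans Mmu) // ltnW // ltn_expl.
have low c : c.1.1 != 0 -> c.1.2 != 0 -> (Q * Q <= 2 * M * N c)%N.
  by move=> c1 c2; rewrite -expnD k0P // (leq_trans kmu) // leq_addr.
have [b [J [JQ enough big_class bound]]] := stepanov_parameters M1 MQ.
have upper c : c \in valid_class -> (M * N c <= Q * Q + 38 * M * Q)%N.
  case/andP=> c1 c2; apply: leq_trans bound; rewrite leq_mul2l; apply/orP; right.
  by apply: (frob_class_bound p_pr mu0 _ enough JQ c1 c2) => c' c1' c2'; apply/big_class/low.
pose Bd : nat := (Q * Q + 38 * M * Q)%N.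
have sumN : (Q * Q <= \sum_(c in valid_class) N c + 2)%N.
  pose one (x : 'F_p) : C := (x != 0)%:R.
  have oneP : mulchar one.
    split; rewrite /one ?eqxx // => x y.
    by rewrite mulf_eq0 negb_or; do 2![case: eqP => _]; rewrite /= ?mulr0 ?mul0r ?mulr1.
  have mm0 : (0 < mu + mu)%N by rewrite addn_gt0 mu0.
  have [//|//|//|n0 n0E] := @trivial_Ssum_ge one one (fun=> 1) _ mm0.
  rewrite expnD -/Q; suff -> : n0 = (\sum_(c in valid_class) N c)%N by [].
  apply/eqP; rewrite -(eqr_nat C) -n0E Ssum_classes // natr_sum; apply/eqP/eq_bigr => c.
  by case/andP=> c1 c2; rewrite /one c1 c2 !mul1r.
have M0 : 0 < M%:R :> R by rewrite ltr0n ltnW.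
(* Subtracting the constant [Bd] is free because a nontrivial triple sums to [0] over the classes.
   The differences then have a constant sign, so the sum of their moduli depends only on the total
   number of points. *)
have SE : M%:R * Ssum emb chi psi e u v (mu + mu) =
    \sum_(c in valid_class) chi c.1.1 * psi c.1.2 * e c.2 * ((M * N c)%:R - Bd%:R).
  under [RHS]eq_bigr do rewrite mulrBr; rewrite sumrB -big_distrl /= sum_valid_class //.
  rewrite mul0r subr0 Ssum_classes // big_distrr /=; apply: eq_bigr => c _.
  by rewrite natrM; ring.
rewrite -(ler_pM2l M0) -{1}(cabs_nat R M) -cabsM SE (le_trans (cabs_sum _ _ _)) //.
apply: (@le_trans _ _ (\sum_(c in valid_class) (Bd%:R - (M * N c)%:R))).
  apply: ler_sum => c cv; have /andP[c1 c2] := cv; rewrite !cabsM.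
  rewrite (cabs_norm1 (norm_mulchar p_pr chiP c1)) (cabs_norm1 (norm_mulchar p_pr psiP c2)).
  rewrite (cabs_norm1 (norm_addchar p_pr _ eP)) !mul1r -cabsN opprB.
  by rewrite -!natrB ?upper // cabs_nat.
rewrite sumrB sumr_const card_valid_class -natr_sum -big_distrr /=.
rewrite -[_ *+ M]mulr_natl -!natrX -/Q -!natrM lerBlDr -natrD ler_nat -mulnDr leq_mul2l.
apply/orP; right.
(* The bound is [38 * M * Q + 2], with [2] from the points missing in [sumN]; it is absorbed in
   [40 * M * Q]. *)
rewrite /Bd; have : (0 < M * Q)%N by rewrite muln_gt0 M0n expn_gt0 prime_gt0.
rewrite -[(38 * M * Q)%N]mulnA -[(40 * M * Q)%N]mulnA.
move: sumN; move: (\sum_(c in _) _)%N (M * Q)%N (Q * Q)%N => s a q; clear; lia.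
Qed.

Lemma weil_bound_sq (chi psi e : 'F_p -> C) : mulchar chi -> mulchar psi -> addchar e ->
  nontrivial_triple chi psi e -> cabs (Hsum chi psi e u v 1) ^+ 2 <= 4 * p%:R.
Proof.
move=> chiP psiP eP nt.
have [a [b [ab mab SE]]] := Ssum_power_sums p_pr emb chiP psiP eP uv nt.
have [mu0 mu0P] := Ssum_weil chiP psiP eP nt.
have p0 : 0 < p%:R :> R by rewrite ltr0n prime_gt0.
have AB : cabs a * cabs b <= p%:R.
  by rewrite -cabsM mab; apply/cabs_le_nat/norm_Hsum2_le.
(* If [cabs x ^+ 2] exceeded [p], the product bound would give [cabs y ^+ 2 <= p], so [y] could not
   cancel the growth of [x ^+ (k + k)] beyond every multiple of [p ^ k]. *)
have root_le (x y : C) : cabs x * cabs y <= p%:R ->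
    (forall m, (0 < m)%N -> Ssum emb chi psi e u v m = - (x ^+ m + y ^+ m)) -> cabs x ^+ 2 <= p%:R.
  move=> xy SE'; rewrite leNgt; apply/negP => px.
  have y2 : cabs y ^+ 2 <= p%:R.
    have := ler_pM (mulr_ge0 (cabs_ge0 x) (cabs_ge0 y)) (mulr_ge0 (cabs_ge0 x) (cabs_ge0 y)) xy xy.
    rewrite mulrACA -!expr2 => xy2; rewrite -(ler_pM2l p0) (le_trans _ xy2) //.
    by rewrite ler_wpM2r ?exprn_ge0 ?cabs_ge0 // ltW.
  have [|k0 k0P] := @expr_unbounded R (cabs x ^+ 2 / p%:R) ((40 * M)%:R + 1).
    by rewrite ltr_pdivlMr // mul1r.
  pose k := maxn 1 (maxn mu0 k0).
  have [k1 kmu kk0] : [/\ (0 < k)%N, (mu0 <= k)%N & (k0 <= k)%N] by rewrite /k; split; lia.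
  have := k0P k kk0; rewrite expr_div_n ltr_pdivlMr ?exprn_gt0 // => kP.
  have yk : (cabs y ^+ 2) ^+ k <= p%:R ^+ k.
    by rewrite lerXn2r // nnegrE ?exprn_ge0 ?cabs_ge0 // ltW.
  have := mu0P k kmu; rewrite SE' ?addn_gt0 ?k1 // cabsN => xyk.
  have : cabs x ^+ (k + k) <= cabs (x ^+ (k + k) + y ^+ (k + k)) + cabs y ^+ (k + k).
    rewrite -!cabsX -[X in cabs X <= _](addrK (y ^+ (k + k))).
    by rewrite (le_trans (cabsD _ _)) // cabsN.
  move: xyk kP; rewrite mulrDl mul1r; set s := cabs (_ + _) => xyk kP.
  by rewrite addnn -mul2n !exprM; lra.
have a2 := root_le a b AB SE.
have b2 : cabs b ^+ 2 <= p%:R.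
  by apply: (root_le b a); rewrite 1?mulrC // => m m0; rewrite SE // addrC.
have -> : cabs (Hsum chi psi e u v 1) = cabs (a + b) by rewrite ab cabsN.
have := cabsD a b; have := cabs_ge0 a; have := cabs_ge0 b; have := cabs_ge0 (a + b).
move: a2 b2; move: (cabs (a + b)) (cabs a) (cabs b) => s x y x2 y2 s0 y0 x0 sxy.
have s2 : s ^+ 2 <= (x + y) ^+ 2 by rewrite lerXn2r // nnegrE addr_ge0.
by have := sqr_ge0 (x - y); move: s2; rewrite sqrrB sqrrD; lra.
Qed.

End Equidistribution.

Lemma weil_bound (R : realType) (p : nat) (al : 'F_p) (u v : 'F_p) (chi psi e : 'F_p -> R[i]) :
  prime p -> p.-1.-primitive_root al -> u != v ->
  mulchar chi -> mulchar psi -> addchar e -> nontrivial_triple chi psi e ->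
  cabs (\sum_x chi (u - x) * psi (v - x) * e (- x)) ^+ 2 <= 4 * p%:R.
Proof.
move=> p_pr al_prim uv chiP psiP eP nt.
have [K [emb _]] := countable_algebraic_closure 'F_p.
have := @weil_bound_sq R p p_pr K emb al al_prim u v uv chi psi e chiP psiP eP nt.
by rewrite Hsum1.
Qed.

(** * Incomplete sums *)

Section UnitCircle.
Variable R : realType.
Implicit Types x y t : R.

Definition expi t : R[i] := (cos t +i* sin t)%C.

Lemma expiD x y : expi (x + y) = expi x * expi y.
Proof. by rewrite /expi cosD sinD; simpc; rewrite [sin x * cos y + _]addrC. Qed.

Lemma expi0 : expi 0 = 1.
Proof. by rewrite /expi cos0 sin0. Qed.

Lemma expiX t k : expi t ^+ k = expi (t *+ k).
Proof.
elim: k => [|k IHk]; first by rewrite expr0 mulr0n expi0.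
by rewrite exprS mulrS expiD IHk.
Qed.

Lemma cabs_sq (a b : R) : cabs (a +i* b)%C ^+ 2 = a ^+ 2 + b ^+ 2.
Proof. by rewrite /cabs normc_def /= sqr_sqrtr // addr_ge0 ?sqr_ge0. Qed.

Lemma cabs_1Bexpi t : 0 <= sin t -> cabs (1 - expi (t *+ 2)) = 2 * sin t.
Proof.
move=> s0; have h : cabs (1 - expi (t *+ 2)) ^+ 2 = (2 * sin t) ^+ 2.
  have -> : 1 - expi (t *+ 2) = ((1 - cos (t *+ 2)) +i* (- sin (t *+ 2)))%C.
    by rewrite /expi; simpc.
  rewrite cabs_sq cos_mulr2n sin_mulr2n; have := cos2Dsin2 t.
  move: (cos t) (sin t) => c s cs.
  have c2 : c ^+ 2 = 1 - s ^+ 2 by rewrite -cs addrK.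
  transitivity (4 * ((1 - c ^+ 2) ^+ 2 + c ^+ 2 * s ^+ 2)); first by rewrite !mulr2n; ring.
  by rewrite c2; ring.
by apply/eqP; rewrite -(@eqrXn2 _ 2) ?cabs_ge0 ?mulr_ge0 //; apply/eqP.
Qed.

(** If [cos t >= 1 / 2] the mean value theorem gives [sin t >= t / 2]; otherwise
    [sin t > 1 / 2 > t / 4], since [t <= pi / 2 < 2]. *)
Lemma sin_ge_quarter t : 0 <= t -> t <= pi / 2 -> t / 4 <= sin t.
Proof.
move=> t0 tpi; have [/eqP->|tn0] := boolP (t == 0); first by rewrite sin0 mul0r.
have tp : 0 < t by rewrite lt0r tn0.
have pi2 := pihalf_lt2 R; have pi0 := pi_gt0 R.
have sin0t : 0 <= sin t by apply: sin_ge0_pi; rewrite t0 /=; lra.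
have [hc|hc] := leP (2^-1) (cos t); last first.
  have c0 : 0 <= cos t by apply: cos_ge0_pihalf; apply/andP; split; lra.
  have := cos2Dsin2 t; move: (cos t) (sin t) hc c0 sin0t => c s hc c0 s0; nra.
have sin_cont : {within `[0, t], continuous (@sin R)}.
  by apply: continuous_subspaceT => x; exact: continuous_sin.
have [c] := MVT tp (fun x _ => is_derive_sin x) sin_cont.
rewrite in_itv /= => /andP[c0 ct]; rewrite sin0 !subr0 => ->.
have cc : cos t < cos c by rewrite ltr_cos // in_itv /=; apply/andP; split; lra.
rewrite [leRHS]mulrC ler_wpM2l //; lra.
Qed.

Lemma inv_le_lnB k : (0 < k)%N -> k.+1%:R^-1 <= ln k.+1%:R - ln k%:R :> R.
Proof.
move=> k0; have kp : 0 < k%:R :> R by rewrite ltr0n.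
have k1p : 0 < k.+1%:R :> R by rewrite ltr0n.
have h : -1 < - k.+1%:R^-1 :> R by rewrite ltrN2 invf_lt1 // ltr1n ltnS.
have := le_ln1Dx h.
have -> : 1 - k.+1%:R^-1 = k%:R / k.+1%:R :> R.
  by apply: (mulIf (lt0r_neq0 k1p)); rewrite mulrBl mul1r mulVf ?lt0r_neq0 // divfK ?lt0r_neq0 //
    -natr1 addrK.
by rewrite lnM ?lnV ?posrE ?invr_gt0 // -lerN2 opprK opprB.
Qed.

Lemma harmonic_le k : \sum_(1 <= a < k.+2) a%:R^-1 <= 1 + ln k.+1%:R :> R.
Proof.
elim: k => [|k IHk]; first by rewrite big_nat1 invr1 ln1 addr0.
rewrite big_nat_recr //= (le_trans (lerD IHk (inv_le_lnB (ltn0Sn k)))) //.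
by rewrite -addrA (addrC (ln _)) subrK.
Qed.

Lemma cabs_geometric (y : R[i]) lo hi : cabs y = 1 -> y != 1 ->
  cabs (\sum_(lo <= j < hi) y ^+ j) <= 2 / cabs (1 - y).
Proof.
move=> y1 yn1; have c0 : 0 < cabs (1 - y).
  rewrite lt0r cabs_ge0 andbT; apply: contraNneq yn1 => c0.
  have : `|1 - y| == 0 by rewrite normC_cabs c0.
  by rewrite normr_eq0 subr_eq0 eq_sym.
rewrite ler_pdivlMr // -cabsM mulrC.
have [hl|lh] := leqP hi lo; first by rewrite big_geq // mulr0 cabs0.
have -> : (1 - y) * \sum_(lo <= j < hi) y ^+ j = y ^+ lo - y ^+ hi.
  rewrite big_distrr /= -[RHS]opprB -(telescope_sumr (fun j => y ^+ j)) ?(ltnW lh) // -sumrN.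
  by apply: eq_bigr => j _; rewrite exprS; ring.
rewrite (le_trans (cabsD _ _)) // cabsN !cabsX y1 !expr1n; lra.
Qed.

End UnitCircle.

(** * Completion by additive characters *)

Section Completion.
Variables (R : realType) (p : nat) (p_pr : prime p).
Local Notation C := R[i].

Definition zeta : C := expi (pi *+ 2 / p%:R).

Lemma zetaX k : zeta ^+ k = expi (pi * k%:R / p%:R *+ 2).
Proof. by rewrite /zeta expiX; congr expi; rewrite !mulr2n -mulr_natr; ring. Qed.

Let p0 : 0 < p%:R :> R. Proof. by rewrite ltr0n prime_gt0. Qed.

Lemma zeta_order : zeta ^+ p = 1.
Proof.
rewrite zetaX mulfK ?lt0r_neq0 // /expi.
by rewrite cos2pi sin2pi.
Qed.

(** The modulus is [2 * sin (pi * k / p)], reflected to [p - k] beyond the middle; [sin t >= t / 4]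
    and [pi >= 2] leave the constant [1]. *)
Lemma cabs_1Bzeta k : (0 < k < p)%N ->
  (minn k (p - k))%:R / p%:R <= cabs (1 - zeta ^+ k).
Proof.
move=> /andP[k0 kp]; rewrite zetaX; have pi2 := pi_ge2 R; have pi0 := pi_gt0 R.
pose t : R := pi * k%:R / p%:R; rewrite -/t.
have kR : 0 < k%:R :> R by rewrite ltr0n.
have kpR : k%:R < p%:R :> R by rewrite ltr_nat.
have t0 : 0 < t by rewrite /t divr_gt0 // mulr_gt0.
have tpi : t < pi by rewrite /t ltr_pdivrMr // ltr_pM2l.
have s0 : 0 <= sin t by apply: sin_ge0_pi; rewrite !ltW.
rewrite cabs_1Bexpi //.
have key (x : R) (j : nat) : x = pi * j%:R / p%:R -> x <= pi / 2 -> sin x = sin t ->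
    j%:R / p%:R <= 2 * sin t.
  move=> xE xpi <-; have x0 : 0 <= x by rewrite xE divr_ge0 ?mulr_ge0 // ltW.
  have := sin_ge_quarter x0 xpi; rewrite {1}xE.
  have : 0 <= j%:R / p%:R :> R by rewrite divr_ge0 // ltW.
  rewrite -[pi * _ / _]mulrA; move: (j%:R / p%:R) (sin x) => y s y0; nra.
have [th|th] := leP t (pi / 2).
  apply: le_trans (key t k erefl th erefl).
  by rewrite ler_wpM2r ?invr_ge0 ?(ltW p0) // ler_nat geq_minl.
have tE : pi - t = pi * (p - k)%:R / p%:R.
  by rewrite natrB ?(ltnW kp) // mulrBr mulrBl mulfK ?lt0r_neq0.
apply: le_trans (key (pi - t) (p - k)%N tE _ _).
- by rewrite ler_wpM2r ?invr_ge0 ?(ltW p0) // ler_nat geq_minr.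
- by lra.
- by rewrite sinB sinpi cospi; ring.
Qed.

Lemma zeta_neq1 k : (0 < k < p)%N -> zeta ^+ k != 1.
Proof.
move=> kp; apply/eqP => z1; have := cabs_1Bzeta kp; rewrite z1 subrr cabs0.
rewrite leNgt => /negP[]; rewrite divr_gt0 // ltr0n; case/andP: kp => k0 kp.
by rewrite leq_min k0 subn_gt0.
Qed.

Lemma cabs_zeta k : cabs (zeta ^+ k) = 1.
Proof.
apply/cabs_norm1/(@unity_norm _ _ p (prime_gt0 p_pr)).
by rewrite exprAC zeta_order expr1n.
Qed.

(** The term [k = 0] costs at most [p]. Each other term is at most [2 * p * (1 / k + 1 / (p - k))],
    so together they cost [4 * p] times a harmonic sum bounded by [1 + ln p]. *)
Lemma sum_geometric_zeta lo hi : (hi <= p)%N ->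
  \sum_(k < p) cabs (\sum_(lo <= j < hi) (zeta ^+ k) ^+ j) <= p%:R * (5 + 4 * ln p%:R).
Proof.
move=> hp; rewrite -(big_mkord xpredT (fun k => cabs (\sum_(lo <= j < hi) (zeta ^+ k) ^+ j))).
rewrite big_ltn ?prime_gt0 //.
have first_le : cabs (\sum_(lo <= j < hi) (zeta ^+ 0) ^+ j) <= p%:R.
  rewrite (le_trans (cabs_sum _ _ _)) //.
  rewrite (eq_bigr (fun=> 1)) => [|j _]; last by rewrite expr0 expr1n (cabs_nat R 1).
  by rewrite sumr_const_nat ler_nat (leq_trans (leq_subr _ _)).
have rest : \sum_(1 <= k < p) cabs (\sum_(lo <= j < hi) (zeta ^+ k) ^+ j)
    <= \sum_(1 <= k < p) (2 * p%:R * (k%:R^-1 + (p - k)%:R^-1)).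
  rewrite big_nat [leRHS]big_nat; apply: ler_sum => k kp.
  rewrite (le_trans (cabs_geometric _ _ (cabs_zeta k) (zeta_neq1 kp))) // -mulrA ler_pM2l //.
  have := cabs_1Bzeta kp; case/andP: kp => k0 kp.
  have kR : 0 < k%:R :> R by rewrite ltr0n.
  have pkR : 0 < (p - k)%:R :> R by rewrite ltr0n subn_gt0.
  set m := minn _ _ => mc; have mR : 0 < m%:R :> R by rewrite ltr0n leq_min k0 subn_gt0.
  apply: (@le_trans _ _ (p%:R * m%:R^-1)).
    by rewrite -[leRHS]invrK invfM invrK mulrC lef_pV2 // posrE ?divr_gt0 // (lt_le_trans _ mc) // divr_gt0.
  rewrite ler_pM2l // /m; case: leqP => _.
    by rewrite lerDl invr_ge0 ltW.
  by rewrite lerDr invr_ge0 ltW.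
have sumE : \sum_(1 <= k < p) (2 * p%:R * (k%:R^-1 + (p - k)%:R^-1))
    = 4 * p%:R * \sum_(1 <= k < p) k%:R^-1 :> R.
  rewrite -big_distrr big_split /=.
  have -> : \sum_(1 <= k < p) (p - k)%:R^-1 = \sum_(1 <= k < p) k%:R^-1 :> R.
    rewrite [RHS]big_nat_rev /=; apply: eq_big_nat => k kp.
    by congr (_%:R^-1); lia.
  ring.
have harm : \sum_(1 <= k < p) k%:R^-1 <= 1 + ln p%:R :> R.
  have := harmonic_le R p.-1; rewrite prednK ?prime_gt0 //.
  rewrite big_nat_recr ?prime_gt0 //=; apply: le_trans.
  by rewrite lerDl invr_ge0 ltW.
have : 4 * p%:R * \sum_(1 <= k < p) k%:R^-1 <= 4 * p%:R * (1 + ln p%:R) :> R.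
  by rewrite ler_pM2l // mulr_gt0.
by move: first_le rest; rewrite sumE; lra.
Qed.

Definition add_e (a : 'F_p) (x : 'F_p) : C := root_addchar zeta (a * x).

Lemma add_e_addchar a : addchar (add_e a).
Proof. by apply/addchar_scale/root_addchar_addchar => //; exact: zeta_order. Qed.

Lemma zeta1_neq1 : zeta != 1.
Proof. by have := @zeta_neq1 1; rewrite expr1 prime_gt1 //; apply. Qed.

Lemma add_e_nontrivial a : a != 0 -> add_nontrivial (add_e a).
Proof.
move=> a0; apply: add_nontrivial_scale => //; apply: root_addchar_nontrivial => //.
exact: zeta1_neq1.
Qed.

Lemma completion (g : 'F_p -> C) (B : R) (r : 'F_p) lo hi : (hi <= p)%N ->
  (forall a, cabs (\sum_x g x * add_e a x) <= B) ->
  cabs (\sum_(lo <= j < hi) g (r + j%:R)) <= B * (5 + 4 * ln p%:R).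
Proof.
move=> hp gB; have eP : addchar (@root_addchar p C zeta).
  by apply: root_addchar_addchar => //; exact: zeta_order.
have ent : add_nontrivial (@root_addchar p C zeta).
  by apply: root_addchar_nontrivial => //; exact: zeta1_neq1.
have inv y : p%:R * g y = \sum_a (\sum_x g x * add_e a x) * add_e a (- y).
  transitivity (\sum_x g x * \sum_a root_addchar zeta (a * (x - y))).
    rewrite (bigD1 y) //= [X in _ + X]big1 ?addr0 => [|x xy].
      by rewrite (sum_addchar_scale p_pr _ eP ent) subrr eqxx mul1r mulrC.
    by rewrite (sum_addchar_scale p_pr _ eP ent) subr_eq0 (negPf xy) mul0r mulr0.
  under eq_bigr do rewrite big_distrr /=; rewrite exchange_big /=.
  apply: eq_bigr => a _; rewrite big_distrl /=; apply: eq_bigr => x _.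
  by rewrite /add_e mulrBr -mulrN; case: eP => _ ->; rewrite mulrA.
rewrite -(ler_pM2l p0) -{1}(cabs_nat R p) -cabsM big_distrr /=.
under eq_bigr do rewrite inv.
rewrite exchange_big /= (le_trans (cabs_sum _ _ _)) //.
apply: (@le_trans _ _ (\sum_(a : 'F_p) B * cabs (\sum_(lo <= j < hi) (zeta ^+ (- a)%R) ^+ j))).
  apply: ler_sum => a _; rewrite -big_distrr cabsM /= ler_pM ?cabs_ge0 //.
  have -> : \sum_(lo <= j < hi) add_e a (- (r + j%:R)) =
      add_e a (- r) * \sum_(lo <= j < hi) (zeta ^+ (- a)%R) ^+ j.
    rewrite big_distrr /=; apply: eq_bigr => j _; rewrite opprD.
    have [_ ->] := add_e_addchar a; congr (_ * _).
    by rewrite /add_e mulrN -mulNr mulr_natr addcharMn.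
  by rewrite cabsM (cabs_norm1 (norm_addchar p_pr _ (add_e_addchar a))) mul1r.
rewrite -big_distrr /= mulrCA ler_wpM2l ?(le_trans _ (gB 0)) ?cabs_ge0 //.
pose F (a : 'F_p) := cabs (\sum_(lo <= j < hi) (zeta ^+ a) ^+ j).
have FN : \sum_(a : 'F_p) F (- a) = \sum_a F a by rewrite [RHS](reindex_inj oppr_inj).
rewrite -[leLHS]/(\sum_(a : 'F_p) F (- a)) FN /F.
apply: le_trans (sum_geometric_zeta lo hp).
have pE : (Zp_trunc (pdiv p)).+2 = p by rewrite pdiv_id // Zp_cast ?prime_gt1.
rewrite -(big_mkord xpredT (fun k => cabs (\sum_(lo <= j < hi) (zeta ^+ k) ^+ j))).
by rewrite -[in leRHS]pE big_mkord.
Qed.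

End Completion.

(** * Cyclotomic patterns and their instances *)

Section Patterns.
Variables (R : realType) (n p : nat) (n_gt0 : (0 < n)%N) (p_pr : prime p) (np : (n %| p.-1)%N).
Variables (al : 'F_p) (al_prim : p.-1.-primitive_root al).
Local Notation C := R[i].
Local Notation S := (Num.sqrt (p%:R : R)).

Definition pers (d : pattern R n) (x : 'F_p) : C :=
  if x == 0 then 0 else d (Ordinal (ltn_pmod (dlog al x) n_gt0)).

Lemma pers0 d : pers d 0 = 0.
Proof. by rewrite /pers eqxx. Qed.

Lemma persq_fromE d f : persq_from al d f -> f =1 pers d.
Proof.
case=> f0 fP x; rewrite /pers; have [->//|x0] := eqVneq x 0.
apply: fP; exists (al ^+ (dlog al x %/ n)).
  by rewrite expf_neq0 // (prim_al_neq0 al_prim).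
by rewrite -exprM -exprD /= addnC -divn_eq dlogK.
Qed.

Lemma pers_al (d : pattern R n) (k : 'I_n) : pers d (al ^+ k) = d k.
Proof.
have alk : al ^+ k != 0 by rewrite expf_neq0 // (prim_al_neq0 al_prim).
rewrite /pers (negPf alk); congr (d _); apply/val_inj => /=.
have /eqP := dlogK p_pr al_prim alk; rewrite (eq_prim_root_expr al_prim) => /eqP dk.
by rewrite -(modn_dvdm _ np) dk (modn_dvdm _ np) modn_small.
Qed.

Lemma pers_inj (d d' : pattern R n) : (forall x, x != 0 -> pers d x = pers d' x) -> d = d'.
Proof.
move=> dd'; apply/ffunP => k; rewrite -!pers_al dd' //.
by rewrite expf_neq0 // (prim_al_neq0 al_prim).
Qed.

Lemma pers_mul_conj (d d' : pattern R n) x :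
  pers d x * (pers d' x)^* = pers [ffun k => d k * (d' k)^*] x.
Proof. by rewrite /pers; case: eqP => [_|_]; rewrite ?mul0r // ffunE. Qed.

Section PatternFourier.
Variables (eta : C) (etaP : n.-primitive_root eta).

Lemma root_order (j : nat) : (eta ^+ j) ^+ p.-1 = 1.
Proof.
have /dvdnP[q ->] := np.
by rewrite mulnC exprM (exprAC _ j) (prim_expr_order etaP) !expr1n.
Qed.

Let chi_ (j : 'I_n) : 'F_p -> C := pow_char al (eta ^+ j).

Let chi_mulchar j : mulchar (chi_ j).
Proof. by apply: pow_char_mulchar => //; exact: root_order. Qed.

Let chi_nontrivial (j : 'I_n) : j != 0%N :> nat -> mul_nontrivial (chi_ j).
Proof.
move=> j0; apply: pow_char_nontrivial => //; first exact: root_order.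
by rewrite -(prim_order_dvd etaP) gtnNdvd // lt0n.
Qed.

Let eta_norm k : `|eta ^+ k| = 1.
Proof. by apply: (@unity_norm _ _ n n_gt0); rewrite exprAC (prim_expr_order etaP) expr1n. Qed.

(** A pattern depends on the logarithm modulo [n] only, so the characters of order dividing [n]
    suffice. The trivial one has the mean of the pattern as coefficient, which is how balance
    enters. *)
Lemma pers_fourier (d : pattern R n) : (forall k, cabs (d k) <= 1) ->
  exists2 c : 'I_n -> C,
    forall j, cabs (c j) <= 1 /\ (j = 0%N :> nat -> c j = n%:R^-1 * \sum_k d k) &
    forall x, pers d x = \sum_j c j * chi_ j x.
Proof.
move=> d1; have nC : n%:R != 0 :> C by rewrite pnatr_eq0 -lt0n.
have nR : 0 < n%:R :> R by rewrite ltr0n.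
exists (fun j => n%:R^-1 * \sum_k d k * (eta ^+ (j * k))^*) => [j|x].
  split=> [|j0]; last first.
    by rewrite j0; under eq_bigr do rewrite mul0n expr0 rmorph1 mulr1.
  rewrite -(ler_pM2l nR) mulr1 -{1}(cabs_nat R n) -cabsM mulVKf // (le_trans (cabs_sum _ _ _)) //.
  apply: (@le_trans _ _ (\sum_(k < n) 1)); last by rewrite sumr_const card_ord.
  by apply: ler_sum => k _; rewrite cabsM cabs_conj (cabs_norm1 (eta_norm _)) mulr1.
rewrite /pers /chi_ /pow_char; have [_|x0] := eqVneq x 0.
  by rewrite big1 // => j _; rewrite mulr0.
set m := dlog al x; set k0 := Ordinal _.
(* The conjugate of a root of unity is rewritten with the exponent [n - k], so that orthogonality
   applies to natural exponents. *)
transitivity (\sum_k d k * (n%:R^-1 * \sum_(j < n) (eta ^+ j) ^+ (m + (n - k)))).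
  rewrite (bigD1 k0) //= [X in _ + X]big1 ?addr0 => [|k kk0].
    under eq_bigr do rewrite exprAC; rewrite (sum_prim_root _ etaP).
    have -> : (n %| m + (n - m %% n))%N.
      have := ltn_pmod m n_gt0 => mn.
      rewrite {1}(divn_eq m n) -addnA subnKC ?(ltnW mn) // dvdn_addl //.
      exact: dvdn_mull.
    by rewrite mul1r mulVf ?mulr1.
  under eq_bigr do rewrite exprAC; rewrite (sum_prim_root _ etaP).
  have -> : (n %| m + (n - k))%N = false.
    apply: contraNF kk0 => nmk; apply/eqP/val_inj => /=.
    have : (m + (n - k) = 0 %[mod n])%N by apply/eqP; rewrite mod0n.
    move/eqP; rewrite -(eqn_modDr k) -addnA subnK ?(ltnW (ltn_ord k)) // modnDr add0n => /eqP ->.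
    by rewrite modn_small.
  by rewrite mul0r mulr0 mulr0.
under eq_bigr do rewrite big_distrr big_distrr /=.
rewrite exchange_big /=; apply: eq_bigr => j _.
rewrite big_distrr big_distrl /=; apply: eq_bigr => k _.
have ek : eta ^+ j ^+ (n - k) = (eta ^+ (j * k))^*.
  apply: (mulfI (_ : eta ^+ (j * k) != 0)).
    by rewrite -normr_eq0 eta_norm oner_eq0.
  rewrite -normCK eta_norm expr1n exprM -exprD subnKC ?(ltnW (ltn_ord k)) //.
  by rewrite exprAC (prim_expr_order etaP) expr1n.
by rewrite exprD ek; ring.
Qed.

Lemma sqrt_bound (x : R) : 0 <= x -> x ^+ 2 <= 4 * p%:R -> x <= 2 * S.
Proof.
move=> x0 xp; rewrite -(@ler_pXn2r _ 2) ?nnegrE ?mulr_ge0 ?sqrtr_ge0 //.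
by rewrite exprMn sqr_sqrtr // expr2; move: xp; lra.
Qed.

(** There are [n ^ 2] pairs of characters. Balance of [d] removes the pairs with trivial [chi_ j];
    the others are Weil sums at the points [t] and [0], after the change of [x] into [- x]. *)
Lemma pers_pair_sum (d d' : pattern R n) (t a : 'F_p) :
  (forall k, `|d k| = 1) -> (forall k, `|d' k| = 1) -> \sum_k d k = 0 -> \sum_k d' k = 0 ->
  t != 0 ->
  cabs (\sum_x (pers d (x + t) * (pers d' x)^*) * add_e R a x) <= n%:R ^+ 2 * (2 * S).
Proof.
move=> d1 d'1 d0 d'0 t0.
have [|c cP dE] := @pers_fourier d; first by move=> k; rewrite cabs_norm1.
have [|c' c'P d'E] := @pers_fourier d'; first by move=> k; rewrite cabs_norm1.
have -> : \sum_x (pers d (x + t) * (pers d' x)^*) * add_e R a x =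
    \sum_j \sum_k (c j * (c' k)^*) * \sum_x chi_ j (x + t) * (chi_ k x)^* * add_e R a x.
  under eq_bigr do rewrite dE d'E rmorph_sum big_distrlr big_distrl /=.
  rewrite exchange_big /=; apply: eq_bigr => j _.
  under eq_bigr do rewrite big_distrl /=.
  rewrite exchange_big /=; apply: eq_bigr => k _.
  by rewrite big_distrr /=; apply: eq_bigr => x _; rewrite rmorphM /=; ring.
have term j k : cabs ((c j * (c' k)^*) * \sum_x chi_ j (x + t) * (chi_ k x)^* * add_e R a x) <= 2 * S.
  have [cj cj0] := cP j; have [ck ck0] := c'P k.
  have S0 : 0 <= 2 * S by rewrite mulr_ge0 ?sqrtr_ge0.
  have [j0|j0] := eqVneq (j : nat) 0%N; first by rewrite cj0 // d0 mulr0 !mul0r cabs0.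
  have psiP : mulchar (fun x => (chi_ k x)^*).
    have [h0 h1 hM] := chi_mulchar k; split; rewrite ?h0 ?h1 ?rmorph0 ?rmorph1 //.
    by move=> x y; rewrite hM rmorphM.
  have nt : nontrivial_triple (chi_ j) (fun x => (chi_ k x)^*) (add_e R a).
    by apply: Or31; apply: chi_nontrivial.
  have := weil_bound p_pr al_prim t0 (chi_mulchar j) psiP (add_e_addchar R p_pr a) nt.
  rewrite (_ : \sum_x _ = \sum_x chi_ j (x + t) * (chi_ k x)^* * add_e R a x); last first.
    by rewrite [LHS](reindex_inj oppr_inj); apply: eq_bigr => x _; rewrite sub0r !opprK addrC.
  move=> /(sqrt_bound (cabs_ge0 _)) hb; rewrite !cabsM cabs_conj.
  rewrite -[leRHS]mul1r ler_pM ?mulr_ge0 ?cabs_ge0 //.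
  by rewrite -[leRHS]mul1r ler_pM ?cabs_ge0.
rewrite (le_trans (cabs_sum _ _ _)) //.
apply: (@le_trans _ _ (\sum_(j < n) \sum_(k < n) 2 * S)).
  by apply: ler_sum => j _; rewrite (le_trans (cabs_sum _ _ _)) // ler_sum.
by rewrite !sumr_const !card_ord -mulrnA -[leLHS]mulr_natl natrM expr2.
Qed.

(** Gauss sums suffice here; the factor [n] is relaxed to [n ^ 2] to share the bound of
    [pers_pair_sum]. *)
Lemma pers_single_sum (g : pattern R n) (a : 'F_p) :
  (forall k, cabs (g k) <= 1) -> \sum_k g k = 0 ->
  cabs (\sum_x pers g x * add_e R a x) <= n%:R ^+ 2 * (2 * S).
Proof.
move=> g1 g0; have [c cP gE] := pers_fourier g1.
have S0 : 0 <= S by rewrite sqrtr_ge0.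
have -> : \sum_x pers g x * add_e R a x = \sum_j c j * \sum_x chi_ j x * add_e R a x.
  under eq_bigr do rewrite gE big_distrl /=.
  rewrite exchange_big /=; apply: eq_bigr => j _.
  by rewrite big_distrr /=; apply: eq_bigr => x _; rewrite mulrA.
have term j : cabs (c j * \sum_x chi_ j x * add_e R a x) <= 2 * S.
  have [cj cj0] := cP j.
  have [j0|j0] := eqVneq (j : nat) 0%N; first by rewrite cj0 // g0 mulr0 mul0r cabs0 mulr_ge0.
  have hb : cabs (\sum_x chi_ j x * add_e R a x) <= 2 * S.
    have [->|a0] := eqVneq a 0.
      rewrite (eq_bigr (chi_ j)) => [|x _]; last by rewrite /add_e /root_addchar mul0r expr0 mulr1.
      by rewrite (sum_mulchar (chi_mulchar j) (chi_nontrivial j0)) cabs0 mulr_ge0.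
    apply: sqrt_bound; first exact: cabs_ge0.
    have := gauss_sum_normsq p_pr (chi_mulchar j) (add_e_addchar R p_pr a) (add_e_nontrivial R p_pr a0).
    rewrite normC_cabs -rmorphXn -(rmorph_nat (real_complex R)) lecR.
    by move=> h; apply: (le_trans h); rewrite ler_peMl // ler1n.
  by rewrite cabsM -[leRHS]mul1r ler_pM ?cabs_ge0.
rewrite (le_trans (cabs_sum _ _ _)) //; apply: (@le_trans _ _ (\sum_(j < n) 2 * S)).
  exact: ler_sum.
rewrite sumr_const card_ord -[leLHS]mulr_natl ler_wpM2r ?mulr_ge0 //.
by rewrite -natrX ler_nat expnS expn1 leq_pmull.
Qed.

Lemma sum_pers (g : pattern R n) : (forall k, cabs (g k) <= 1) ->
  \sum_x pers g x = p.-1%:R * (n%:R^-1 * \sum_k g k).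
Proof.
move=> g1; have [c cP gE] := pers_fourier g1.
under eq_bigr do rewrite gE.
rewrite exchange_big /= (bigD1 (Ordinal n_gt0)) //= [X in _ + X]big1 ?addr0 => [|j j0].
  rewrite -big_distrr /= (cP _).2 // mulrC; congr (_ * _).
  rewrite (bigD1 0) //= (eq_bigr (fun=> 1)) => [|x x0]; last first.
    by rewrite /chi_ /pow_char (negPf x0) expr0 expr1n.
  rewrite /chi_ /pow_char eqxx add0r sumr_const; congr (_%:R).
  by have := cardC1 (0 : 'F_p); rewrite card_Fp // => <-; apply: eq_card.
by rewrite -big_distrr /= (sum_mulchar (chi_mulchar j)) ?mulr0 //; apply: chi_nontrivial.
Qed.

End PatternFourier.

Definition unimod_of (d : pattern R n) (F : 'F_p -> C) : Prop :=
  (forall x, x != 0 -> F x = pers d x) /\ `|F 0| = 1.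

Lemma cabs_unimod (d : pattern R n) F x : (forall k, `|d k| = 1) -> unimod_of d F -> cabs (F x) = 1.
Proof.
move=> d1 [FE F0]; have [->|x0] := eqVneq x 0; first exact: cabs_norm1.
by rewrite FE // /pers (negPf x0) cabs_norm1.
Qed.

Lemma sum_natr_Fp (V : nmodType) (G : 'F_p -> V) :
  \sum_(0 <= j < p) G j%:R = \sum_x G x.
Proof.
have pE : (Zp_trunc (pdiv p)).+2 = p by rewrite pdiv_id // Zp_cast ?prime_gt1.
rewrite -{1}pE big_mkord; apply: eq_bigr => x _; congr G.
exact: natr_Zp.
Qed.

Lemma count_zero (y : 'F_p) lo hi : (hi <= p)%N ->
  \sum_(lo <= j < hi) ((y + j%:R == 0)%:R : R) <= 1.
Proof.
move=> hp; apply: (@le_trans _ _ (\sum_(0 <= j < p) ((y + j%:R == 0)%:R : R))).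
  have [hl|lh] := leqP hi lo; first by rewrite big_geq // sumr_ge0.
  rewrite (@big_cat_nat _ _ _ lo 0 p) //= ?(leq_trans (ltnW lh)) //.
  rewrite (@big_cat_nat _ _ _ hi lo p) //= ?(ltnW lh) //.
  by rewrite ler_wpDl ?ler_wpDr ?sumr_ge0.
rewrite (sum_natr_Fp (fun x => ((y + x == 0)%:R : R))) (bigD1 (- y)) //= subrr eqxx.
by rewrite big1 ?addr0 // => x; rewrite addrC addr_eq0 => /negPf ->.
Qed.

(** Each of the two arguments meets [0] at most once in the range; at such an index the product of
    [pers] values is [0] and the unimodular one has modulus [1]. *)
Lemma unimod_sum_near (d d' : pattern R n) F G (x y : 'F_p) lo hi : (hi <= p)%N ->
  (forall k, `|d k| = 1) -> (forall k, `|d' k| = 1) -> unimod_of d F -> unimod_of d' G ->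
  cabs (\sum_(lo <= j < hi) F (x + j%:R) * (G (y + j%:R))^*) <=
  cabs (\sum_(lo <= j < hi) pers d (x + j%:R) * (pers d' (y + j%:R))^*) + 2.
Proof.
move=> hp d1 d'1 Fd Gd'.
pose f j := F (x + j%:R) * (G (y + j%:R))^*.
pose g j := pers d (x + j%:R) * (pers d' (y + j%:R))^*.
have -> : \sum_(lo <= j < hi) f j = \sum_(lo <= j < hi) g j + \sum_(lo <= j < hi) (f j - g j).
  by rewrite sumrB addrC subrK.
rewrite (le_trans (cabsD _ _)) // lerD2l (le_trans (cabs_sum _ _ _)) //.
apply: (@le_trans _ _ (\sum_(lo <= j < hi) ((x + j%:R == 0)%:R + (y + j%:R == 0)%:R))).
  apply: ler_sum => j _; rewrite /f /g.
  have Fj := cabs_unimod (x + j%:R) d1 Fd; have Gj := cabs_unimod (y + j%:R) d'1 Gd'.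
  have fg1 : cabs (F (x + j%:R) * (G (y + j%:R))^*) = 1 by rewrite cabsM cabs_conj Fj Gj mulr1.
  have [x0|x0] := eqVneq (x + j%:R) 0.
    by rewrite x0 pers0 mul0r subr0 -x0 fg1 lerDl ler0n.
  have [y0|y0] := eqVneq (y + j%:R) 0.
    by rewrite y0 pers0 rmorph0 mulr0 subr0 -y0 fg1 add0r.
  by rewrite Fd.1 // Gd'.1 // subrr cabs0 addr0.
by rewrite big_split /= -[2]/(1 + 1) lerD // count_zero.
Qed.

(** At [t = 0] the two patterns multiply to a single pattern, whose balance is the orthogonality of
    [d] and [d']. *)
Lemma incomplete_bound (d d' : pattern R n) F G (t y : 'F_p) lo hi : (hi <= p)%N ->
  (forall k, `|d k| = 1) -> (forall k, `|d' k| = 1) -> unimod_of d F -> unimod_of d' G ->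
  (t != 0 /\ \sum_k d k = 0 /\ \sum_k d' k = 0) \/
  (t = 0 /\ \sum_k d k * (d' k)^* = 0) ->
  cabs (\sum_(lo <= j < hi) F (y + t + j%:R) * (G (y + j%:R))^*) <=
  n%:R ^+ 2 * (2 * S) * (5 + 4 * ln p%:R) + 2.
Proof.
move=> hp d1 d'1 Fd Gd' H; have [eta etaP] := prim_root_exists C n_gt0.
rewrite (le_trans (unimod_sum_near _ _ _ hp d1 d'1 Fd Gd')) // lerD2r.
pose g x := pers d (x + t) * (pers d' x)^*.
rewrite (eq_bigr (fun j => g (y + j%:R))) => [|j _]; last by rewrite /g addrAC.
apply: completion => // a; case: H => [[t0 [d0 d'0]]|[t0 dd'0]].
  exact: (pers_pair_sum etaP).
have -> : \sum_x g x * add_e R a x = \sum_x pers [ffun k => d k * (d' k)^*] x * add_e R a x.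
  by apply: eq_bigr => x _; rewrite /g t0 addr0 pers_mul_conj.
apply: (pers_single_sum etaP) => [k|]; last by under eq_bigr do rewrite ffunE.
by rewrite ffunE cabsM cabs_conj !cabs_norm1 // mulr1.
Qed.

End Patterns.

(** * Aperiodic correlations of rotated sequences *)

Section Rotations.
Variables (R : realType) (p : nat) (p_pr : prime p).
Local Notation C := R[i].

Lemma rotation_in (F : 'F_p -> C) (r : int) (j : nat) : (j < p)%N ->
  rotation F r j = F (r%:~R + j%:R).
Proof.
move=> jp; rewrite /rotation ifT; first by rewrite rmorphD.
by apply/andP; split; lia.
Qed.

Lemma rotation_out (F : 'F_p -> C) (r j : int) : ~~ (0 <= j < p%:Z) -> rotation F r j = 0.
Proof. by move=> jp; rewrite /rotation ifN //; lia. Qed.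

Lemma crosscorr_rotation_pos (F G : 'F_p -> C) (r r' : int) (k : nat) :
  crosscorr (rotation F r) (rotation G r') k =
  \sum_(0 <= j < p - k) F (r%:~R + k%:R + j%:R) * (G (r'%:~R + j%:R))^*.
Proof.
rewrite /crosscorr (@fsbigE _ _ _ _ _ (map Posz (index_iota 0 (p - k)))) //.
- rewrite big_map (eq_bigl xpredT) => [|j]; last by rewrite in_setT.
  apply: eq_big_nat => j /andP[_ jp].
  have jp' : (j < p)%N by lia.
  by rewrite rotation_in // -PoszD rotation_in ?natrD ?[_ + k%:R + _]addrAC ?addrA //; lia.
- by rewrite map_inj_uniq ?iota_uniq // => x y [].
- move=> j _ jn; have [jp|jp] := boolP (0 <= j < p%:Z); last by rewrite (rotation_out _ _ jp) rmorph0 mulr0.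
  rewrite rotation_out ?mul0r //; apply: contra jn => jk; apply/mapP; exists `|j|%N; last by lia.
  by rewrite mem_index_iota; lia.
Qed.

Lemma crosscorr_rotation_neg (F G : 'F_p -> C) (r r' : int) (k : nat) :
  crosscorr (rotation F r) (rotation G r') (- k%:Z) =
  \sum_(k <= j < p) F (r%:~R - k%:R + j%:R) * (G (r'%:~R + j%:R))^*.
Proof.
rewrite /crosscorr (@fsbigE _ _ _ _ _ (map Posz (index_iota k p))) //.
- rewrite big_map (eq_bigl xpredT) => [|j]; last by rewrite in_setT.
  apply: eq_big_nat => j /andP[kj jp].
  rewrite (rotation_in G) // subzn // rotation_in ?natrB //; last by lia.
  by congr (F _ * _); rewrite addrA addrAC.
- by rewrite map_inj_uniq ?iota_uniq // => x y [].
- move=> j _ jn; have [jp|jp] := boolP (0 <= j < p%:Z); last by rewrite (rotation_out _ _ jp) rmorph0 mulr0.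
  rewrite rotation_out ?mul0r //; apply: contra jn => jk; apply/mapP; exists `|j|%N; last by lia.
  by rewrite mem_index_iota; lia.
Qed.

(** The emptiness clause serves autocorrelations at nonzero shifts divisible by [p]: these shifts
    vanish in ['F_p], and no cancellation is available. *)
Lemma crosscorr_rotationE (F G : 'F_p -> C) (r r' s : int) : exists lo hi : nat,
  [/\ (hi <= p)%N, (p%:Z <= `|s| -> (hi <= lo)%N) &
  crosscorr (rotation F r) (rotation G r') s =
  \sum_(lo <= j < hi) F (r%:~R + s%:~R + j%:R) * (G (r'%:~R + j%:R))^*].
Proof.
case: (intP s) => [|k|k].
- by exists 0%N, p; split; [by [] | lia | rewrite (crosscorr_rotation_pos F G r r' 0) subn0].
- by exists 0%N, (p - k.+1)%N; split; [lia | lia | rewrite crosscorr_rotation_pos].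
- by exists k.+1, p; split; [lia | lia | rewrite crosscorr_rotation_neg rmorphN].
Qed.

(** The shifts [k] and [k - p] agree in ['F_p], and their ranges, cut at [p - k], partition one full
    period. *)
Lemma crosscorr_two_shifts (F G : 'F_p -> C) (r r' : int) (k : nat) : (k <= p)%N ->
  crosscorr (rotation F r) (rotation G r') k +
  crosscorr (rotation F r) (rotation G r') (k%:Z - p%:Z) =
  \sum_x F (r%:~R + k%:R - r'%:~R + x) * (G x)^*.
Proof.
move=> kp; rewrite crosscorr_rotation_pos.
have -> : k%:Z - p%:Z = - (p - k)%N%:Z by lia.
rewrite crosscorr_rotation_neg.
have pF : p%:R = 0 :> 'F_p by rewrite pchar_Fp_0.
have -> : r%:~R - (p - k)%:R = r%:~R + k%:R :> 'F_p by rewrite natrB // pF sub0r opprK.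
rewrite -big_cat_nat ?leq_subr //=.
rewrite (sum_natr_Fp p_pr (fun x => F (r%:~R + k%:R + x) * (G (r'%:~R + x))^*)).
rewrite [RHS](reindex_inj (addrI r'%:~R)) /=; apply: eq_bigr => x _.
by rewrite addrA subrK.
Qed.

Lemma periodic_shift (t : 'F_p) (r r' : int) : exists2 k : nat, (k < p)%N &
  r%:~R + k%:R - r'%:~R = t :> 'F_p.
Proof.
pose x : 'F_p := t + r'%:~R - r%:~R; exists x.
  have pE : (Zp_trunc (pdiv p)).+2 = p by rewrite pdiv_id // Zp_cast ?prime_gt1.
  by rewrite -[ltnRHS]pE ltn_ord.
have -> : (x : nat)%:R = x by exact: natr_Zp.
by rewrite /x; ring.
Qed.

End Rotations.

(** * Upper and lower bounds for [GUC] of an instance *)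

Section Instances.
Variables (R : realType) (n p : nat) (n_gt0 : (0 < n)%N) (p_pr : prime p) (np : (n %| p.-1)%N).
Variables (al : 'F_p) (al_prim : p.-1.-primitive_root al).
Variables (D : {fset pattern R n}) (D0 : D != fset0) (D1 : unimodular_plan D).
Variables (ft : pattern R n -> 'F_p -> R[i]) (r : pattern R n -> int) (A : set (int -> R[i])).
Hypothesis ftP : forall d, d \in D -> unimod_of n_gt0 al d (ft d).
Hypothesis AE : A = [set rotation (ft d) (r d) | d in [set d | d \in D]].
Local Notation S := (Num.sqrt (p%:R : R)).
Local Notation rot d := (rotation (ft d) (r d)).

Lemma plan_inhabited : exists d, d \in D.
Proof. by case/fset0Pn: D0 => d dD; exists d. Qed.

Lemma cabs_ft d x : d \in D -> cabs (ft d x) = 1.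
Proof. by move=> dD; apply: cabs_unimod (D1 dD) (ftP dD). Qed.

Lemma cabs_crosscorr_le d d' s : d \in D -> d' \in D ->
  cabs (crosscorr (rot d) (rot d') s) <= p%:R.
Proof.
move=> dD d'D; have [lo [hi [hp _ ->]]] := crosscorr_rotationE p_pr (ft d) (ft d') (r d) (r d') s.
rewrite (le_trans (cabs_sum _ _ _)) // (eq_bigr (fun=> 1)) => [|j _].
  by rewrite sumr_const_nat ler_nat (leq_trans (leq_subr _ _)).
by rewrite cabsM cabs_conj !cabs_ft // mulr1.
Qed.

Lemma autocorr0 d : d \in D -> crosscorr (rot d) (rot d) 0 = p%:R.
Proof.
move=> dD; rewrite (crosscorr_rotation_pos p_pr _ _ _ _ 0) subn0 addr0.
rewrite (eq_bigr (fun=> 1)) => [|j _]; last by rewrite -normCK normC_cabs cabs_ft // expr1n.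
by rewrite sumr_const_nat subn0.
Qed.

Lemma SDC_instance : SDC A = p%:R.
Proof.
have [d dD] := plan_inhabited; rewrite /SDC (_ : [set _ | _] = [set p%:R]) ?inf1 //.
apply/seteqP; split=> [x /= [f]|x /= ->].
  rewrite AE => -[d' /= d'D <-]; rewrite autocorr0 // -(rmorph_nat (real_complex R)).
  exact: complexI.
exists (rot d); first by rewrite AE; exists d.
by rewrite autocorr0 // rmorph_nat.
Qed.

Let corr_set := [set x : R | exists (f g : int -> R[i]) (s : int),
         [/\ A f, A g, ~ (f = g /\ s = 0) & x = cabs (crosscorr f g s)]].

Lemma le_GUC d d' s : d \in D -> d' \in D -> ~ (rot d = rot d' /\ s = 0) ->
  cabs (crosscorr (rot d) (rot d') s) <= GUC A.
Proof.
move=> dD d'D ne; apply: (@ub_le_sup _ corr_set).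
  exists p%:R => _ [f [g [s' [Af Ag _ ->]]]]; move: Af Ag; rewrite AE.
  by move=> -[e /= eD <-] [e' /= e'D <-]; exact: cabs_crosscorr_le.
by exists (rot d), (rot d'), s; split=> //; rewrite AE; [exists d|exists d'].
Qed.

Lemma GUC_le B : (forall d d' s, d \in D -> d' \in D -> ~ (rot d = rot d' /\ s = 0) ->
  cabs (crosscorr (rot d) (rot d') s) <= B) -> GUC A <= B.
Proof.
move=> HB; have [d dD] := plan_inhabited; apply: (@sup_le_ub _ corr_set).
  exists (cabs (crosscorr (rot d) (rot d) 1)), (rot d), (rot d), 1.
  by split=> //; [rewrite AE; exists d|rewrite AE; exists d|case].
move=> _ [f [g [s [Af Ag ne ->]]]]; move: Af Ag ne; rewrite AE.
by move=> -[e /= eD <-] [e' /= e'D <-]; exact: HB.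
Qed.

(** All entries have modulus [1], so the support is the whole window from [0] to [p - 1]. *)
Lemma length_instance l : codebook_length A l -> l = p.
Proof.
have [d dD] := plan_inhabited; move=> lenA; have Ad : A (rot d) by rewrite AE; exists d.
have p1 := prime_gt1 p_pr.
have rot_neq0 (j : int) : (rot d j != 0) = (0 <= j < p%:Z).
  have [jp|jp] := boolP (0 <= j < p%:Z); last by rewrite (rotation_out p_pr) // eqxx.
  have -> : j = `|j|%N by lia.
  rewrite (rotation_in p_pr); last by lia.
  apply/eqP => h; have := cabs_ft ((r d)%:~R + `|j|%:R) dD.
  by rewrite h cabs0 => /eqP; rewrite eq_sym oner_eq0.
case: (lenA _ Ad) => [[_ /(_ 0) z0]|[l0 [a [a0 al0 supp]]]].
  by have := rot_neq0 0; rewrite z0 eqxx; lia.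
rewrite rot_neq0 in a0; rewrite rot_neq0 in al0.
have s0 : a <= 0 <= a + l%:Z - 1 by apply: supp; rewrite rot_neq0; lia.
have sp : a <= p%:Z - 1 <= a + l%:Z - 1 by apply: supp; rewrite rot_neq0; lia.
by clear -a0 al0 s0 sp; lia.
Qed.

Lemma GUC_upper : balanced_plan D -> orthogonal_plan D ->
  GUC A <= n%:R ^+ 2 * (2 * S) * (5 + 4 * ln p%:R) + 2.
Proof.
move=> bal orth; apply: GUC_le => d d' s dD d'D ne.
have [lo [hi [hp short ->]]] := crosscorr_rotationE p_pr (ft d) (ft d') (r d) (r d') s.
pose t : 'F_p := (r d)%:~R + s%:~R - (r d')%:~R.
have tE : (r d)%:~R + s%:~R = (r d')%:~R + t :> 'F_p by rewrite /t addrCA subrr addr0.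
under eq_bigr do rewrite tE.
have bound := incomplete_bound p_pr np al_prim (r d')%:~R lo hp (D1 dD) (D1 d'D) (ftP dD) (ftP d'D).
have [t0|t0] := eqVneq t 0; last by apply: bound; left; rewrite (bal _ dD) (bal _ d'D).
have [dd'|dd'] := eqVneq d d'; last by apply: bound; right; rewrite (orth _ _ dD d'D dd').
(* What remains is one pattern against itself at a nonzero multiple of [p], where the range of
   summation is empty. *)
rewrite -dd' in t0 ne *.
have s0 : s != 0 by apply/eqP => s0; apply: ne.
have sp : (p %| `|s|)%N.
  have pch : p \in [pchar 'F_p] by exact: pchar_Fp.
  rewrite (dvdn_pcharf pch); move: t0; rewrite /t -dd' addrAC subrr add0r.
  by case: (intP s) => // k; rewrite ?rmorphN /= => /eqP; rewrite ?oppr_eq0 => h.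
have s_gt0 : (0 < `|s|)%N by rewrite absz_gt0.
have hl : (hi <= lo)%N by apply: short; have := dvdn_leq s_gt0 sp; lia.
rewrite big_geq // cabs0.
have ln0 : 0 <= ln p%:R :> R by rewrite ln_ge0 // ler1n prime_gt0.
by rewrite addr_ge0 // !mulr_ge0 ?sqrtr_ge0 ?addr_ge0 ?mulr_ge0 ?exprn_ge0.
Qed.

(** Distinct patterns can give the same sequence only through rotations that differ modulo [p]; this
    separates them from the excluded triples [(f, f, 0)]. *)
Lemma rot_inj d d' : d \in D -> d' \in D -> (r d)%:~R = (r d')%:~R :> 'F_p ->
  rot d = rot d' -> d = d'.
Proof.
move=> dD d'D rr rotE; have ftE x : ft d x = ft d' x.
  have [k kp xE] := periodic_shift p_pr x 0 (- r d).
  have {xE} -> : x = (r d)%:~R + k%:R by rewrite -xE rmorphN /= opprK add0r addrC.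
  by rewrite {2}rr -!(rotation_in p_pr _ _ kp) rotE.
apply: (pers_inj p_pr np al_prim) => x x0.
by rewrite -(ftP dD).1 // -(ftP d'D).1.
Qed.

(** Neither of the two aperiodic shifts is excluded: [k - p] is nonzero, and [k = 0] with equal
    sequences would contradict either [t != 0] or [d != d']. *)
Lemma le_GUC_periodic d d' (t : 'F_p) : d \in D -> d' \in D ->
  (t != 0 /\ d = d') \/ (t = 0 /\ d != d') ->
  cabs (\sum_x ft d (t + x) * (ft d' x)^*) <= 2 * GUC A.
Proof.
move=> dD d'D td; have [k kp kt] := periodic_shift p_pr t (r d) (r d').
have := crosscorr_two_shifts p_pr (ft d) (ft d') (r d) (r d') (ltnW kp).
rewrite kt => <-; rewrite (le_trans (cabsD _ _)) // -[2]/(1 + 1) mulrDl mul1r.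
apply: lerD; apply: le_GUC => // -[rotE /eqP k0]; last by lia.
have {}k0 : k = 0%N by lia.
move: kt; rewrite k0 addr0; case: td => [[t0 <-]|[-> dd'] /eqP].
  by rewrite subrr => /esym/eqP; rewrite (negPf t0).
by rewrite subr_eq0 => /eqP rr; rewrite (rot_inj dD d'D rr rotE) eqxx in dd'.
Qed.

Lemma cabs_invn : cabs (n%:R^-1 : R[i]) = n%:R^-1.
Proof. by apply: cabs_eq; rewrite normfV normr_nat fmorphV rmorph_nat. Qed.

(** Outside [0], each product [d k] times the conjugate of [d' k] is repeated [(p - 1) / n] times in
    the correlation at shift [0]; the [- 1] pays for the entry at [0]. *)
Lemma GUC_ge_inner d d' : d \in D -> d' \in D -> d != d' ->
  p.-1%:R * (cabs (\sum_k d k * (d' k)^*) / n%:R) - 1 <= 2 * GUC A.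
Proof.
move=> dD d'D dd'; have [eta etaP] := prim_root_exists R[i] n_gt0.
have := @le_GUC_periodic d d' 0 dD d'D (or_intror (conj erefl dd')); apply: le_trans.
have -> : \sum_x ft d (0 + x) * (ft d' x)^* =
    \sum_x pers n_gt0 al [ffun k => d k * (d' k)^*] x + ft d 0 * (ft d' 0)^*.
  rewrite [LHS](bigD1 0) //= [X in _ = X + _](bigD1 0) //= pers0 !add0r addrC.
  congr (_ + _); apply: eq_bigr => x x0.
  by rewrite add0r (ftP dD).1 // (ftP d'D).1 // pers_mul_conj.
rewrite (sum_pers n_gt0 p_pr np al_prim etaP) => [|k]; last first.
  by rewrite ffunE cabsM cabs_conj (cabs_norm1 (D1 dD k)) (cabs_norm1 (D1 d'D k)) mulr1.
rewrite (eq_bigr (fun k => d k * (d' k)^*) (fun k _ => ffunE _ k)).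
set T := \sum_k _; set z := _ * (_)^*.
have z1 : cabs z = 1 by rewrite /z cabsM cabs_conj !cabs_ft // mulr1.
have : cabs (p.-1%:R * (n%:R^-1 * T)) <= cabs (p.-1%:R * (n%:R^-1 * T) + z) + 1.
  rewrite -{1}[X in cabs X](addrK z) (le_trans (cabsD _ _)) // cabsN z1 //.
by rewrite !cabsM cabs_nat cabs_invn lerBlDr (mulrC _ (cabs T)).
Qed.

(* The periodic autocorrelations of [F] over all shifts sum to [`|\sum_x F x| ^ 2]. *)
Lemma GUC_ge_unbalanced d : d \in D -> 1 <= p.-1%:R * (cabs (\sum_k d k) / n%:R) ->
  (p.-1%:R * (cabs (\sum_k d k) / n%:R) - 1) ^+ 2 <= p%:R + p%:R * (2 * GUC A).
Proof.
move=> dD big1'; have [eta etaP] := prim_root_exists R[i] n_gt0.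
pose F := ft d; pose s := \sum_x F x.
have sE : s = p.-1%:R * (n%:R^-1 * \sum_k d k) + F 0.
  rewrite -(sum_pers n_gt0 p_pr np al_prim etaP) => [|k]; last by rewrite (cabs_norm1 (D1 dD k)).
  rewrite /s [LHS](bigD1 0) //= [X in _ = X + _](bigD1 0) //= pers0 add0r addrC.
  by congr (_ + _); apply: eq_bigr => x x0; rewrite /F (ftP dD).1.
have s_ge : p.-1%:R * (cabs (\sum_k d k) / n%:R) - 1 <= cabs s.
  have F1 : cabs (F 0) = 1 by rewrite /F cabs_ft.
  have : cabs (p.-1%:R * (n%:R^-1 * \sum_k d k)) <= cabs s + 1.
    have -> : p.-1%:R * (n%:R^-1 * \sum_k d k) = s - F 0 by rewrite sE addrK.
    by rewrite (le_trans (cabsD _ _)) // cabsN F1.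
  by rewrite !cabsM cabs_nat cabs_invn lerBlDr (mulrC _ (cabs (\sum_k d k))).
have corrE : s * s^* = \sum_t \sum_x F (t + x) * (F x)^*.
  rewrite /s rmorph_sum big_distrlr /= exchange_big [RHS]exchange_big /=.
  by apply: eq_bigr => x _; rewrite (reindex_inj (addIr x)).
have s2 : cabs s ^+ 2 = cabs (\sum_t \sum_x F (t + x) * (F x)^*).
  by rewrite -corrE cabsM cabs_conj expr2.
apply: le_trans (_ : cabs s ^+ 2 <= _).
  by rewrite lerXn2r // nnegrE ?cabs_ge0 // subr_ge0.
rewrite s2 (bigD1 0) //= (le_trans (cabsD _ _)) // lerD //.
  under eq_bigr do rewrite add0r -normCK normC_cabs /F cabs_ft // expr1n.
  by rewrite sumr_const card_Fp // cabs_nat.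
rewrite (le_trans (cabs_sum _ _ _)) //.
apply: (@le_trans _ _ (\sum_(t : 'F_p | t != 0) 2 * GUC A)).
  by apply: ler_sum => t t0; apply: le_GUC_periodic => //; left.
have G0 : 0 <= 2 * GUC A.
  have := @le_GUC_periodic d d 1 dD dD (or_introl (conj (oner_neq0 _) erefl)).
  exact/le_trans/cabs_ge0.
rewrite sumr_const -[leLHS]mulr_natl ler_wpM2r // ler_nat.
by rewrite (leq_trans (max_card _)) // card_Fp.
Qed.

End Instances.

(** * Growth estimates and the equivalence *)

(** Half of the surplus exponent [e] absorbs the logarithm, through [ln x <= 2 / e * x ^ (e / 2)],
    and the other half sends the quotient to [0]. In [L], [8 * K / e] is [4 * K] times [2 / e]. *)
Lemma powR_dominates (R : realType) (K e d : R) : 0 <= K -> 0 < e -> 0 < d ->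
  exists M : R, forall x : R, M < x ->
    (K * Num.sqrt x * (5 + 4 * ln x) + 2) / (x `^ (2^-1 + e)) < d.
Proof.
move=> K0 e0 d0; pose L := 5 * K + 8 * K / e + 2.
have L0 : 0 < L by rewrite /L ltr_wpDl // addr_ge0 // ?mulr_ge0 ?invr_ge0 // ltW.
exists (Num.max 1 ((L / d) `^ (2 / e))) => x; rewrite gt_max => /andP[x1 xL].
have x0 : 0 < x by rewrite (lt_trans _ x1).
have xe0 : 0 < x `^ (e / 2) by rewrite powR_gt0.
have e20 : 0 < e / 2 by rewrite divr_gt0.
have xe1 : 1 <= x `^ (e / 2) by have := ler_powR (ltW x1) (ltW e20); rewrite powRr0.
have sx1 : 1 <= Num.sqrt x by rewrite -[leLHS]sqrtr1 ler_wsqrtr // ltW.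
have lnx : ln x <= 2 / e * x `^ (e / 2).
  have := ltW (ln_sublinear xe0); rewrite ln_powR => h.
  have -> : ln x = 2 / e * (e / 2 * ln x) by field; rewrite gt_eqF.
  by rewrite ler_wpM2l // divr_ge0 // ltW.
have xLd : L / d < x `^ (e / 2).
  have := gt0_ltr_powR e20 _ _ xL; rewrite -powRrM !nnegrE powR_ge0 (ltW x0) => /(_ isT isT).
  rewrite (_ : 2 / e * (e / 2) = 1) ?powRr1 ?divr_ge0 // ?ltW //.
  by field; rewrite gt_eqF.
have pE : x `^ (2^-1 + e) = Num.sqrt x * (x `^ (e / 2) * x `^ (e / 2)).
  rewrite powRD; last by rewrite (gt_eqF x0) implybT.
  rewrite powR12_sqrt ?(ltW x0) // -powRD; last by rewrite (gt_eqF x0) implybT.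
  by congr (_ * x `^ _); field.
have s0 : 0 < Num.sqrt x by rewrite sqrtr_gt0.
rewrite pE ltr_pdivrMr ?mulr_gt0 //.
apply: (@le_lt_trans _ _ (Num.sqrt x * (L * x `^ (e / 2)))).
  have h1 : K * (5 + 4 * ln x) + 2 <= L * x `^ (e / 2).
    have a1 : K * (4 * ln x) <= 8 * K / e * x `^ (e / 2).
      rewrite (_ : 8 * K / e * _ = K * (4 * (2 / e * x `^ (e / 2)))); last by field; rewrite gt_eqF.
      by rewrite ler_wpM2l // ler_pM2l.
    have a2 : 5 * K <= 5 * K * x `^ (e / 2) by rewrite ler_peMr // mulr_ge0.
    by rewrite /L !mulrDl mulrDr; lra.
  rewrite -(ler_pM2l s0) in h1; apply: le_trans h1.
  rewrite [leRHS]mulrDr lerD //; last by rewrite ler_peMl.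
  by rewrite mulrCA mulrA.
rewrite [ltRHS]mulrCA ltr_pM2l // mulrA ltr_pM2r //.
by move: xLd; rewrite ltr_pdivrMr // mulrC.
Qed.

Lemma instance_data (R : realType) (n : nat) (n_gt0 : (0 < n)%N) (alpha : forall p : nat, 'F_p)
    (D : {fset pattern R n}) (A : set (int -> R[i])) :
  (forall p : nat, prime p -> primitive_elt (alpha p)) -> unimod_instance D alpha A ->
  exists (p : nat) (ft : pattern R n -> 'F_p -> R[i]) (r : pattern R n -> int),
    [/\ prime p, (n %| p.-1)%N,
        forall d, d \in D -> unimod_of n_gt0 (alpha p) d (ft d) &
        A = [set rotation (ft d) (r d) | d in [set d | d \in D]]].
Proof.
move=> alP [p [p_pr pn [ft [r [ftP AE]]]]]; exists p, ft, r; split=> //.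
  by rewrite -subn1 -eqn_mod_dvd ?prime_gt0 //; apply/eqP.
move=> d /ftP[f fP [ffE f1]]; split=> // x x0.
by rewrite ffE // (persq_fromE n_gt0 p_pr (alP p p_pr) fP).
Qed.

Lemma cabs_gt0 (R : realType) (z : R[i]) : z != 0 -> 0 < cabs z.
Proof.
move=> z0; rewrite lt0r cabs_ge0 andbT; apply: contraNneq z0 => cz.
by rewrite -normr_eq0 normC_cabs cz.
Qed.

Lemma half_le_pred (R : realType) p : (1 < p)%N -> p%:R / 2 <= p.-1%:R :> R.
Proof. by move=> p1; rewrite ler_pdivrMr // -natrM ler_nat; lia. Qed.

(** Past the threshold [1 < P * k / 4], so [q * k - 1] exceeds [P * k / 4] and [G] exceeds
    [P * k / 8]. *)
Lemma linear_growth_absurd (R : realType) (k q P G : R) : 0 < k -> P / 2 <= q -> 4 / k < P ->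
  q * k - 1 <= 2 * G -> G < k / 8 * P -> False.
Proof.
move=> k0 qP Pk kq Gk; have h := ler_wpM2l (ltW k0) qP.
have h4 : 4 < P * k by rewrite -ltr_pdivrMr.
nra.
Qed.

(** The summand [4 / k] yields [q * k - 1 >= P * k / 4], whose square is [P ^ 2 * k ^ 2 / 16], while
    [2 * P * G] takes at most half of this. There remains [P * k ^ 2 <= 32], against the summand
    [32 / k ^ 2]. *)
Lemma quadratic_growth_absurd (R : realType) (k q P G : R) : 0 < k -> P / 2 <= q ->
  4 / k + 32 / k ^+ 2 < P ->
  (1 <= q * k -> (q * k - 1) ^+ 2 <= P + P * (2 * G)) -> G < k ^+ 2 / 64 * P -> False.
Proof.
move=> k0 qP Pk qG Gk; have k20 : 0 < k ^+ 2 by rewrite exprn_gt0.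
have a1 : 0 < 4 / k by rewrite divr_gt0.
have a2 : 0 < 32 / k ^+ 2 by rewrite divr_gt0.
have P0 : 0 < P by lra.
have h4 : 4 < P * k by rewrite -ltr_pdivrMr //; lra.
have h32 : 32 < P * k ^+ 2 by rewrite -ltr_pdivrMr //; lra.
have h := ler_wpM2r (ltW k0) qP.
have qk : P * k / 4 <= q * k - 1 by lra.
have := qG ltac:(lra) => hq.
have sq : (P * k / 4) ^+ 2 <= (q * k - 1) ^+ 2 by rewrite lerXn2r // nnegrE; lra.
have hG : P * (2 * G) <= P * (k ^+ 2 / 32 * P) by rewrite ler_pM2l //; lra.
have h5 : P * 32 < P * (P * k ^+ 2) by rewrite ltr_pM2l.
have e1 : (P * k / 4) ^+ 2 = P * (P * k ^+ 2) / 16 by field.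
have e2 : P * (k ^+ 2 / 32 * P) = P * (P * k ^+ 2) / 32 by field.
rewrite e1 in sq; rewrite e2 in hG; lra.
Qed.

Unset Implicit Arguments.

Theorem theorem1p1 (R : realType) (n : nat) (alpha : forall p : nat, 'F_p)
  (D : {fset pattern R n}) (Fam : set (set (int -> R[i]))) :
  (0 < n)%N ->
  (forall p : nat, prime p -> primitive_elt (alpha p)) ->
  D != fset0 ->
  unimodular_plan D ->
  (forall A, Fam A -> unimod_instance D alpha A) ->
  (forall M : nat, exists2 A, Fam A &
     exists2 l : nat, (M < l)%N & codebook_length A l) ->
  (well_regulated_GUC Fam <-> balanced_plan D /\ orthogonal_plan D).
Proof.
move=> n0 alP D0 D1 inst long.
have data A := fun FA => instance_data n0 alP (inst A FA).
have large (M : R) : exists2 A, Fam A & exists (p : nat) ft r,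
    [/\ M < p%:R, prime p, (n %| p.-1)%N,
        forall d, d \in D -> unimod_of n0 (alpha p) d (ft d) &
        A = [set rotation (ft d) (r d) | d in [set d | d \in D]]].
  have [A FA [l lM lenA]] := long (Num.bound `|M|); exists A => //.
  have [p [ft [r [p_pr np ftP AE]]]] := data A FA; exists p, ft, r; split=> //.
  rewrite -(length_instance p_pr np (alP p p_pr) D0 D1 ftP AE lenA) (le_lt_trans (ler_norm M)) //.
  by rewrite (lt_trans (archi_boundP (normr_ge0 M))) // ltr_nat.
split=> [[_ growth]|[bal orth]].
(* Necessity uses a single exponent: [eps = 1 / 2] turns the growth condition into [GUC = o(p)]. *)
- have linear (e : R) : 0 < e -> exists M : R, forall p ft r A, Fam A -> prime p -> M < p%:R ->
      (forall d, d \in D -> unimod_of n0 (alpha p) d (ft d)) ->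
      A = [set rotation (ft d) (r d) | d in [set d | d \in D]] -> GUC A < e * p%:R.
    have h2 : 0 < 2^-1 :> R by rewrite invr_gt0.
    move=> e0; have [M MP] := growth _ h2 e e0; exists M => p ft r A FA p_pr Mp ftP AE.
    have := MP A FA; rewrite (SDC_instance p_pr D0 D1 ftP AE) => /(_ Mp).
    have -> : 2^-1 + 2^-1 = 1 :> R by lra.
    by rewrite powRr1 // ltr_pdivrMr // ltr0n prime_gt0.
  have nR : 0 < n%:R :> R by rewrite ltr0n.
  split=> [d dD|d d' dD d'D dd']; apply/eqP/negP => /negP sn0.
  + pose k := cabs (\sum_k d k) / n%:R.
    have k0 : 0 < k by rewrite divr_gt0 // cabs_gt0.
    have [|M MP] := linear (k ^+ 2 / 64); first by rewrite divr_gt0 // exprn_gt0.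
    have [A FA [p [ft [r [Mp p_pr np ftP AE]]]]] := large (Num.max M (4 / k + 32 / k ^+ 2)).
    move: Mp; rewrite gt_max => /andP[Mp kp].
    have := MP p ft r A FA p_pr Mp ftP AE.
    have := GUC_ge_unbalanced p_pr np (alP p p_pr) D0 D1 ftP AE dD; rewrite -/k.
    exact: quadratic_growth_absurd k0 (half_le_pred R (prime_gt1 p_pr)) kp.
  + pose k := cabs (\sum_k d k * (d' k)^*) / n%:R.
    have k0 : 0 < k by rewrite divr_gt0 // cabs_gt0.
    have [|M MP] := linear (k / 8); first by rewrite divr_gt0.
    have [A FA [p [ft [r [Mp p_pr np ftP AE]]]]] := large (Num.max M (4 / k)).
    move: Mp; rewrite gt_max => /andP[Mp kp].
    have := MP p ft r A FA p_pr Mp ftP AE.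
    have := GUC_ge_inner p_pr np (alP p p_pr) D0 D1 ftP AE dD d'D dd'; rewrite -/k.
    exact: linear_growth_absurd k0 (half_le_pred R (prime_gt1 p_pr)) kp.
- split=> [M|e e0 d d0].
    have [A FA [p [ft [r [Mp p_pr np ftP AE]]]]] := large M; exists A => //.
    by rewrite (SDC_instance p_pr D0 D1 ftP AE).
  have K0 : 0 <= n%:R ^+ 2 * 2 :> R by rewrite mulr_ge0 ?exprn_ge0.
  have [M MP] := powR_dominates K0 e0 d0; exists M => A FA.
  have [p [ft [r [p_pr np ftP AE]]]] := data A FA.
  rewrite (SDC_instance p_pr D0 D1 ftP AE) => Mp; apply: le_lt_trans (MP _ Mp).
  rewrite ler_pM2r ?invr_gt0 ?powR_gt0 ?ltr0n ?prime_gt0 // -[_ * 2 * _]mulrA.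
  exact: (GUC_upper p_pr np (alP p p_pr) D0 D1 ftP AE bal orth).
Qed.
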